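(* Let $T$ be a regular interval exchange transformation defined over a quadratic field. Then the interval exchange set $F(T)$ is primitive morphic.
   Context: An $s$-interval exchange transformation $T$ on $[\ell,r[$ over a finite alphabet $A=\{a_1<_1\cdots<_1a_s\}$ with a second total order $<_2$ is given by a partition $(I_a)_{a\in A}$ of $[\ell,r[$ into semi-intervals $I_a=[\gamma_a,\mu_a[$ (sets $[\alpha,\beta[=\{z:\alpha\le z<\beta\}$) of lengths $\lambda_a>0$ placed left to right in the order $<_1$; with $\nu_a=\ell+\sum_{b\le_2a}\lambda_b$, $T(z)=z+\nu_a-\mu_a$ on $I_a$. $T$ is defined over a quadratic field if all $\lambda_a$ belong to $\mathbb Q(\sqrt d)$ for some square-free integer $d\ge2$. $T$ is regular if the orbits of $\gamma_{a_2},\dots,\gamma_{a_s}$ are infinite and pairwise disjoint; regular implies minimal. Natural coding: $\Sigma_T(z)=c_0c_1\cdots$ with $c_n=a$ iff $T^n(z)\in I_a$; for minimal $T$, $F(T)$ is the set of finite factors of $\Sigma_T(z)$, independent of $z$. A morphism $f:C^*\to C^*$ is primitive if there is $k$ with every letter occurring in $f^k(c)$ for every letter $c$; if $f(c)$ begins with $c$ and $|f^n(c)|\to\infty$, $f^\omega(c)$ is the infinite word having all $f^n(c)$ as prefixes. An infinite word $y$ over $A$ is primitive morphic if $y=\sigma(x)$ for some morphism $\sigma:C^*\to A^*$ and some $x=f^\omega(c)$ with $f$ primitive. A set of words is primitive morphic if it equals the set of factors of a primitive morphic infinite word. *)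

(* Defs.v *)
From HB Require Import structures.
From mathcomp Require Import all_boot all_order all_algebra.
From mathcomp Require Import boolp classical_sets cardinality reals.

Set Implicit Arguments.
Unset Strict Implicit.
Unset Printing Implicit Defensive.

Import Order.TTheory GRing.Theory Num.Theory.

Local Open Scope ring_scope.
Local Open Scope classical_set_scope.

(** * Infinite words and primitive morphic sets *)

Definition infinite_word (A : Type) := nat -> A.

Definition prefix_of (A : eqType) (u : seq A) (x : infinite_word A) : Prop :=
  u = mkseq x (size u).

Definition factor_of (A : eqType) (w : seq A) (y : infinite_word A) : Prop :=
  exists k : nat, w = mkseq (fun i => y (k + i)%N) (size w).

(** A morphism C^* -> A^* is given by the images of the letters. *)
Definition morph_ext (C A : Type) (f : C -> seq A) (w : seq C) : seq A :=
  flatten (map f w).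

Definition primitive_morphism (C : finType) (f : C -> seq C) : Prop :=
  exists k : nat, forall c b : C, b \in iter k (morph_ext f) [:: c].

(** x = f^omega(c), including the conditions under which it is defined. *)
Definition is_fixed_point (C : finType) (f : C -> seq C) (c : C)
    (x : infinite_word C) : Prop :=
  [/\ prefix [:: c] (f c),
      forall N : nat, exists n0 : nat, forall n : nat, (n0 <= n)%N ->
        (N <= size (iter n (morph_ext f) [:: c]))%N
    & forall n : nat, prefix_of (iter n (morph_ext f) [:: c]) x].

(** y = sigma(x); sigma may erase letters, so the second clause says that
    sigma(x) is an infinite word. *)
Definition is_image (C A : finType) (sigma : C -> seq A)
    (x : infinite_word C) (y : infinite_word A) : Prop :=
  (forall n : nat, prefix_of (morph_ext sigma (mkseq x n)) y) /\
  (forall N : nat, exists n : nat, (N <= size (morph_ext sigma (mkseq x n)))%N).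

Definition primitive_morphic_word (A : finType) (y : infinite_word A) : Prop :=
  exists (C : finType) (f : C -> seq C) (c : C) (x : infinite_word C)
         (sigma : C -> seq A),
    [/\ primitive_morphism f, is_fixed_point f c x & is_image sigma x y].

Definition primitive_morphic_set (A : finType) (F : set (seq A)) : Prop :=
  exists2 y : infinite_word A,
    primitive_morphic_word y & F = [set w | factor_of w y].

(** * Interval exchange transformations *)

Definition total_order (A : eqType) (le : rel A) : Prop :=
  [/\ total le, antisymmetric le & transitive le].

Record iet (R : realType) (A : finType) := Iet {
  iet_l : R;
  le1 : rel A;
  le2 : rel A;
  len : A -> R;
  le1_order : total_order le1;
  le2_order : total_order le2;
  len_gt0 : forall a, 0 < len a }.

Section IntervalExchange.
Variables (R : realType) (A : finType) (T : iet R A).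

Definition iet_r : R := iet_l T + \sum_a len T a.

Definition iet_dom : set R := `[iet_l T, iet_r[.

Definition gamma (a : A) : R :=
  iet_l T + \sum_(b | le1 T b a && (b != a)) len T b.

Definition mu (a : A) : R := iet_l T + \sum_(b | le1 T b a) len T b.

Definition nu (a : A) : R := iet_l T + \sum_(b | le2 T b a) len T b.

Definition semi_interval (a : A) : interval R := `[gamma a, mu a[%R.

(** The semi-intervals partition [iet_dom]; outside it, the map is the identity,
    an irrelevant value. *)
Definition iet_map (z : R) : R :=
  if [pick a | z \in semi_interval a] is Some a then z + nu a - mu a else z.

(** The two-sided orbit {T^n(z) | n in Z}: T is a bijection of [iet_dom], and
    T^(-n)(z) is the point of [iet_dom] that T^n maps to z. *)
Definition orbit (z : R) : set R :=
  [set w | iet_dom w /\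
    exists n : nat, iter n iet_map z = w \/ iter n iet_map w = z].

Definition not_first (a : A) : Prop := exists b : A, le1 T b a && (b != a).

Definition regular : Prop :=
  (forall a, not_first a -> infinite_set (orbit (gamma a))) /\
  (forall a b, not_first a -> not_first b -> a != b ->
    orbit (gamma a) `&` orbit (gamma b) = set0).

Definition natural_coding (z : R) (c : infinite_word A) : Prop :=
  forall (n : nat) (a : A), c n = a <-> iter n iet_map z \in semi_interval a.

(** The set F(T), computed from the point z of [iet_dom].  For z in [iet_dom]
    there is exactly one natural coding c. *)
Definition interval_exchange_set (z : R) : set (seq A) :=
  [set w | exists2 c, natural_coding z c & factor_of w c].

End IntervalExchange.

Definition square_free (d : nat) : Prop :=
  forall k : nat, (k ^ 2 %| d)%N -> k = 1%N.

(** x belongs to Q(sqrt d) = {p + q sqrt d | p, q in Q}. *)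
Definition in_quadratic_field (R : realType) (d : nat) (x : R) : Prop :=
  exists p q : rat, x = ratr p + ratr q * Num.sqrt d%:R.

Definition over_quadratic_field (R : realType) (A : finType) (T : iet R A) :
    Prop :=
  exists d : nat, [/\ (2 <= d)%N, square_free d
    & forall a : A, in_quadratic_field d (len T a)].

(* Main.v *)
(** Let l be the left end of the domain. Lengths and displacements lie in a
    module M = g Z[sqrt d]; call height of an element the size of its
    conjugate. A nonzero element of M of height h is at least of order 1/h,
    since its norm is a nonzero integer.

    If an interval U has end points of height h, the points entering U at time
    exactly t, when there are any, contain an interval of length of order
    1/(t + h). These intervals are disjoint for distinct t and the harmonic
    series diverges, so entrance times into U are O(h); applied to the inverse
    of T, this bounds the return times to U. Regularity excludes periodic points
    and, with these bounds, nontrivial invariant sets, so every orbit enters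
    every interval within a bounded time.

    Two of the n + 1 first points of the orbit of l are O(1/n) apart, which
    gives eps_n = O(1/n) in M of height O(n). The return times to
    J_n = [l, l + eps_n[ are O(n), so the break points and displacements of the
    map induced on J_n have height O(n) as well; divided by eps_n they belong to
    a finite set independent of n. By the pigeonhole principle the maps induced
    on J_n and on a much smaller J_m coincide up to scaling. Both then give the
    same coding x of the orbit of l, and reading the visits to J_n along the
    returns to J_m is a substitution fixing x, primitive because long returns
    visit every cell of J_n. *)
Require Import Defs.
From mathcomp Require Import all_boot all_order all_algebra.
From mathcomp Require Import boolp classical_sets cardinality reals.
From mathcomp Require Import zify ring lra.

Set Implicit Arguments.
Unset Strict Implicit.
Unset Printing Implicit Defensive.

Import Order.TTheory GRing.Theory Num.Theory.

Local Open Scope ring_scope.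

(** * Heights in quadratic modules *)

Section Lattice.
Variables (R : realType) (d : nat) (g : R).

Let s : R := Num.sqrt d%:R.

(** [lattice h x]: the point [x] of the module [g * Z[sqrt d]] has a conjugate
    of absolute value at most [g * h]. *)
Definition lattice (h : nat) (x : R) : Prop :=
  exists m n : int, x = (m%:~R + n%:~R * Num.sqrt d%:R) * g /\
    `|m%:~R - n%:~R * Num.sqrt d%:R| <= h%:R :> R.

Lemma lattice_leq (h k : nat) (x : R) :
  (h <= k)%N -> lattice h x -> lattice k x.
Proof.
move=> hk [m [n [-> le_mn]]]; exists m, n; split=> //.
by apply: le_trans le_mn _; rewrite ler_nat.
Qed.

Lemma lattice0 : lattice 0 0.
Proof. by exists 0, 0; rewrite !mul0r subr0 addr0 mul0r normr0. Qed.

Lemma latticeD (h k : nat) (x y : R) :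
  lattice h x -> lattice k y -> lattice (h + k) (x + y).
Proof.
move=> [m [n [-> mnP]]] [m' [n' [-> mnP']]]; exists (m + m'), (n + n').
split; first by rewrite !intrD; ring.
rewrite natrD; apply: le_trans (lerD mnP mnP'); rewrite !intrD.
by apply: le_trans (ler_normD _ _); rewrite le_eqVlt; apply/orP; left;
  apply/eqP; congr `|_|; ring.
Qed.

Lemma latticeN (h : nat) (x : R) : lattice h x -> lattice h (- x).
Proof.
move=> [m [n [-> mnP]]]; exists (- m), (- n).
by rewrite !intrN; split; [ring | rewrite -normrN; apply: le_trans mnP;
  rewrite le_eqVlt; apply/orP; left; apply/eqP; congr `|_|; ring].
Qed.

Lemma latticeB (h k : nat) (x y : R) :
  lattice h x -> lattice k y -> lattice (h + k) (x - y).
Proof. by move=> hx hy; apply: latticeD => //; apply: latticeN. Qed.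

Lemma lattice_sum (I : finType) (P : pred I) (h : nat) (F : I -> R) :
  (forall i, lattice h (F i)) -> lattice (#|I| * h) (\sum_(i | P i) F i).
Proof.
move=> hF; suff: lattice (\sum_(i | P i) h) (\sum_(i | P i) F i).
  apply: lattice_leq; rewrite sum_nat_const leq_mul2r.
  by rewrite max_card orbT.
elim/big_ind2: _ => //; [exact: lattice0 | move=> *; exact: latticeD].
Qed.

Hypotheses (d_gt1 : (2 <= d)%N) (d_sqfree : square_free d) (g_gt0 : 0 < g).

Let s_sqr : s * s = d%:R.
Proof. by rewrite -expr2 sqr_sqrtr ?ler0n. Qed.

Let s_ge1 : 1 <= s.
Proof. by rewrite -[1]sqrtr1 ler_wsqrtr ?ler1n ?(ltn_trans _ d_gt1). Qed.

(** Irrationality of [sqrt d]: if [n] is nonzero, then [n ^ 2] divides [m ^ 2], so [n] divides [m]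
    and [d] is a square, against square-freeness and [2 <= d]. *)
Let norm_eq0 (m n : int) : m * m = d%:Z * (n * n) -> n = 0.
Proof.
move=> /(congr1 absz); rewrite !abszM absz_nat => mn.
case: (posnP `|n|%N) => [|n_gt0]; first by move/eqP; rewrite absz_eq0 => /eqP.
have /dvdnP[k km] : (`|n| %| `|m|)%N.
  by rewrite -(@dvdn_pexp2r _ _ 2) // -!mulnn mn dvdn_mull.
have dE : d = (k ^ 2)%N.
  apply/eqP; rewrite -(@eqn_pmul2r (`|n| * `|n|)%N) ?muln_gt0 ?n_gt0 //.
  by rewrite -mn km -mulnn; apply/eqP; ring.
have k1 : k = 1%N by apply: d_sqfree; rewrite -dE.
by move: d_gt1; rewrite dE k1.
Qed.

Let conj_normE (m n : int) :
  (m%:~R + n%:~R * s) * (m%:~R - n%:~R * s) = (m * m - d%:Z * (n * n))%:~R :> R.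
Proof. by rewrite intrB !intrM -[(d%:Z)%:~R]/(d%:R) -s_sqr; ring. Qed.

Let conj_norm_ge1 (m n : int) : m%:~R + n%:~R * s != 0 :> R ->
  1 <= `|m%:~R + n%:~R * s| * `|m%:~R - n%:~R * s| :> R.
Proof.
move=> nz; rewrite -normrM conj_normE -intr_norm -[1]/(1%:~R) ler_int.
suff: m * m - d%:Z * (n * n) != 0 by rewrite -normr_gt0 gtz0_ge1.
apply: contra nz; rewrite subr_eq0 => /eqP mn.
have n0 := norm_eq0 mn; move: mn; rewrite n0 !mulr0 => /eqP.
by rewrite mulf_eq0 orbb => /eqP ->; rewrite mul0r addr0.
Qed.

Lemma lattice_lower_bound (h : nat) (x : R) :
  lattice h x -> 0 < x -> g <= x * h%:R.
Proof.
move=> [m [n [-> mnP]]]; rewrite pmulr_lgt0 // => mn_gt0.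
rewrite mulrAC ler_peMl ?(ltW g_gt0) //.
apply: le_trans (conj_norm_ge1 (lt0r_neq0 mn_gt0)) _.
by rewrite gtr0_norm // ler_wpM2l // ltW.
Qed.

(* Multiplying numerator and denominator by the conjugate of the denominator
   turns the quotient into one of elements of bounded height. *)
Lemma lattice_ratio_finite (B : nat) : exists F : seq R,
  forall (h k : nat) (e eps : R), lattice h e -> lattice k eps -> 0 < eps ->
    `|e| <= eps -> eps * h%:R <= B%:R * g -> eps * k%:R <= B%:R * g ->
    e / eps \in F.
Proof.
pose I := [seq (i%:Z - B%:Z : int) | i <- iota 0 (B + B).+1].
have inI (m : int) : `|m%:~R : R| <= B%:R -> m \in I.
  rewrite -intr_norm -[B%:R]/((B%:Z)%:~R) ler_int => mB.
  by apply/mapP; exists (absz (m + B%:Z)); [rewrite mem_iota; lia | lia].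
exists [seq x / p%:~R | x <- [seq m%:~R + n%:~R * s | m <- I, n <- I], p <- I].
move=> h k _ _ [m [n [-> mnP]]] [m' [n' [-> mnP']]].
rewrite -/s in mnP mnP' *; rewrite pmulr_lgt0 // => eps_gt0.
rewrite normrM (gtr0_norm g_gt0) ler_pM2r // => le_e.
move=> hB kB; move: hB; rewrite mulrAC ler_pM2r // => hB.
move: kB; rewrite mulrAC ler_pM2r // => kB.
(* [P] is the norm of the denominator, [M] and [N] the coordinates of the numerator times the
   conjugate of the denominator. All three turn out to be at most [B] in absolute value. *)
set P := m' * m' - d%:Z * (n' * n').
set M := m * m' - d%:Z * (n * n').
set N := n * m' - m * n'.
have PE : (m'%:~R + n'%:~R * s) * (m'%:~R - n'%:~R * s) = P%:~R := conj_normE _ _.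
have MN : (m%:~R + n%:~R * s) * (m'%:~R - n'%:~R * s) = M%:~R + N%:~R * s.
  by rewrite /M /N !intrB !intrM -[(d%:Z)%:~R]/(d%:R) -s_sqr; ring.
have MN' : (m%:~R - n%:~R * s) * (m'%:~R + n'%:~R * s) = M%:~R - N%:~R * s.
  by rewrite /M /N !intrB !intrM -[(d%:Z)%:~R]/(d%:R) -s_sqr; ring.
have P_bound : `|P%:~R : R| <= B%:R.
  rewrite -PE normrM (gtr0_norm eps_gt0); apply: le_trans kB.
  by rewrite ler_wpM2l // ltW.
have b1 : `|M%:~R + N%:~R * s| <= B%:R.
  by rewrite -MN normrM; apply: le_trans kB; apply: ler_pM.
have b2 : `|M%:~R - N%:~R * s| <= B%:R.
  rewrite -MN' normrM (gtr0_norm eps_gt0) mulrC; apply: le_trans hB.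
  by rewrite ler_wpM2l // ltW.
have P_neq0 : P%:~R != 0 :> R.
  rewrite -PE -normr_gt0 normrM; apply: lt_le_trans ltr01 _.
  by apply: conj_norm_ge1; rewrite lt0r_neq0.
have Ns_bound : `|N%:~R * s| <= B%:R.
  by move: b1 b2; rewrite !ler_norml => /andP[? ?] /andP[? ?]; apply/andP; lra.
have -> : (m%:~R + n%:~R * s) * g / ((m'%:~R + n'%:~R * s) * g) =
    (M%:~R + N%:~R * s) / P%:~R.
  have w'_neq0 : m'%:~R - n'%:~R * s != 0 :> R.
    by apply: contraNneq P_neq0 => w0; rewrite -PE w0 mulr0.
  rewrite -MN -PE; field.
  by rewrite w'_neq0 (lt0r_neq0 eps_gt0) (lt0r_neq0 g_gt0).
apply/allpairsP; exists (M%:~R + N%:~R * s, P); split; last by [].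
  apply/allpairsP; exists (M, N); split; last by [].
    apply: inI; move: b1 b2; rewrite !ler_norml.
    by move=> /andP[? ?] /andP[? ?]; apply/andP; lra.
  apply: inI; apply: le_trans Ns_bound; rewrite normrM ler_peMr //.
  by rewrite ger0_norm ?(le_trans ler01).
exact: inI.
Qed.

End Lattice.

(** [g] is the inverse of a common denominator of all coordinates, and [h] bounds the finitely many
    conjugates. *)
Lemma common_lattice (R : realType) (d : nat) (I : finType) (x : I -> R) :
  (forall i, in_quadratic_field d (x i)) ->
  exists g : R, 0 < g /\ exists h, forall i, lattice d g h (x i).
Proof.
move=> /choice[p /choice[q xE]].
pose N := (\prod_i (denq (p i) * denq (q i)))%R.
have N_gt0 : 0 < N by apply: prodr_gt0 => i _; rewrite mulr_gt0 ?denq_gt0.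
have Nint (z : rat) : (denq z %| N)%Z ->
    exists m : int, ratr z = m%:~R * (N%:~R)^-1 :> R.
  move=> /dvdzP[k NE]; exists (numq z * k).
  have Nz : N%:~R != 0 :> R by rewrite intr_eq0 gt_eqF.
  apply: (mulIf Nz); rewrite mulfVK // NE !intrM /ratr.
  by field; rewrite intr_eq0 denq_eq0.
have dvdp i : (denq (p i) %| N)%Z.
  by rewrite /N (bigD1 i) //=; apply/dvdz_mulr/dvdz_mulr.
have dvdq i : (denq (q i) %| N)%Z.
  by rewrite /N (bigD1 i) //=; apply/dvdz_mulr/dvdz_mull.
have /choice[m pm] := fun i => Nint _ (dvdp i).
have /choice[n qn] := fun i => Nint _ (dvdq i).
exists (N%:~R)^-1; split; first by rewrite invr_gt0 ltr0z.
pose c i : R := `|(m i)%:~R - (n i)%:~R * Num.sqrt d%:R|.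
exists (\sum_i (Num.truncn (c i)).+1)%N => i; exists (m i), (n i); split.
  by rewrite xE pm qn; ring.
apply: (@le_trans _ _ (Num.truncn (c i)).+1%:R).
  by apply: ltW; apply: truncnS_gt.
by rewrite ler_nat (bigD1 i) //= leq_addr.
Qed.

(** Once the interval with the largest right end is removed, the others lie to the left of its left
    end, which serves as the new [r]. *)
Lemma disjoint_intervals_sum (R : realType) (I : finType) (S : {set I})
    (u v : I -> R) (l r : R) : l <= r ->
  (forall i, i \in S -> [/\ l <= u i, u i < v i & v i <= r]) ->
  (forall i j, i \in S -> j \in S -> i != j -> v i <= u j \/ v j <= u i) ->
  \sum_(i in S) (v i - u i) <= r - l.
Proof.
move: {-1}#|S| (leqnn #|S|) => n; elim: n S r => [|n IHn] S r.
  rewrite leqn0 cards_eq0 => /eqP -> lr _ _.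
  by rewrite big_set0 subr_ge0.
move=> leS lr inS dis; have [->|/finset.set0Pn[i0 i0S]] := eqVneq S finset.set0.
  by rewrite big_set0 subr_ge0.
case: (@arg_maxP _ _ _ i0 (mem S) v i0S) => i iS maxv; change (is_true (i \in S)) in iS.
rewrite (big_setD1 i iS) /=.
have [lui uvi vir] := inS i iS.
suff: \sum_(j in S :\ i) (v j - u j) <= u i - l by lra.
apply: IHn => //.
- by move: leS; rewrite (cardsD1 i) iS.
- move=> j; rewrite !inE => /andP[ji jS]; have [? ? ?] := inS j jS; split=> //.
  by have [//|] := dis j i jS iS ji; have := maxv j jS; rewrite /Order.ge /=; lra.
- by move=> j k /setD1P[_ jS] /setD1P[_ kS]; apply: dis.
Qed.

(** The block of [t] from [h * (2 ^ j - 1)] to [h * (2 ^ j.+1 - 1)] has [h * 2 ^ j] terms, each at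
    least [1 / (h * 2 ^ j.+1)], and so adds at least one half. *)
Lemma harmonic_lower_bound (R : realType) (h j : nat) : (0 < h)%N ->
  j%:R / 2 <= \sum_(0 <= t < h * (2 ^ j).-1) ((t + h)%:R)^-1 :> R.
Proof.
move=> h_gt0; elim: j => [|j IHj]; first by rewrite mul0r muln0 big_nil.
have e2 : (0 < 2 ^ j)%N by rewrite expn_gt0.
rewrite (@big_cat_nat _ _ _ (h * (2 ^ j).-1)) //=; last first.
  by rewrite leq_mul2l expnS; apply/orP; right; lia.
have -> : j.+1%:R / 2 = j%:R / 2 + 2^-1 :> R by rewrite -natr1 mulrDl mul1r.
apply: lerD IHj _.
have cnt : (h * (2 ^ j.+1).-1 - h * (2 ^ j).-1 = h * 2 ^ j)%N.
  by rewrite -mulnBr; congr muln; rewrite expnS; lia.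
have -> : 2^-1 = \sum_(h * (2 ^ j).-1 <= t < h * (2 ^ j.+1).-1)
    ((h * 2 ^ j.+1)%:R)^-1 :> R.
  rewrite sumr_const_nat cnt -mulr_natl expnS mulnCA !natrM.
  by field; rewrite !pnatr_eq0 -!lt0n e2.
rewrite !big_nat; apply: ler_sum => t /andP[_ tlt].
rewrite lef_pV2 ?posrE ?ltr0n ?muln_gt0 ?addn_gt0 ?h_gt0 ?expn_gt0 ?orbT //.
have -> : (h * 2 ^ j.+1 = h * (2 ^ j.+1).-1 + h)%N.
  have: (0 < 2 ^ j.+1)%N by rewrite expn_gt0.
  by case: (2 ^ j.+1)%N => // k _ /=; rewrite mulnS addnC.
by rewrite ler_nat leq_add2r ltnW.
Qed.

Lemma infinite_pigeonhole (I : finType) (f : nat -> I) :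
  exists i, forall N, exists2 n, (N <= n)%N & f n = i.
Proof.
apply/not_existsP => no_i.
have /choice[N Nf] : forall i, exists N, forall n, (N <= n)%N -> f n <> i.
  move=> i; have /existsNP[N /forall2NP NN] := no_i i; exists N => n nN.
  by case: (NN n).
pose M := (\max_i N i)%N.
exact: (Nf (f M) M (leq_bigmax _)).
Qed.

Lemma seq_min (R : realType) (x0 : R) (s : seq R) : x0 \in s ->
  exists2 x, x \in s & forall y, y \in s -> x <= y.
Proof.
elim: s x0 => // x s IHs x0 _; case: s IHs => [|x1 s] IHs.
  by exists x; rewrite ?mem_seq1 // => y; rewrite mem_seq1 => /eqP ->.
have [m ms mP] := IHs x1 (mem_head _ _).
have [le_xm|/ltW le_mx] := lerP x m.
  exists x; rewrite ?mem_head // => y; rewrite in_cons => /orP[/eqP -> //|/mP].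
  exact: le_trans.
exists m => [|y]; first by rewrite in_cons ms orbT.
by rewrite in_cons => /orP[/eqP ->|/mP].
Qed.

(** * Interval exchange maps *)

Section Partition.
Variables (R : realType) (A : finType) (le : rel A) (w : A -> R) (l : R).
Hypotheses (le_order : total_order le) (w_gt0 : forall a, 0 < w a).

Let le_total : total le. Proof. by case: le_order. Qed.
Let le_anti : antisymmetric le. Proof. by case: le_order. Qed.
Let le_tr : transitive le. Proof. by case: le_order. Qed.
Let le_refl a : le a a. Proof. by have := le_total a a; rewrite orbb. Qed.

Let lo a := l + \sum_(b | le b a && (b != a)) w b.
Let hi a := l + \sum_(b | le b a) w b.
Let r := l + \sum_a w a.

Lemma partition_hiE a : hi a = lo a + w a.
Proof. by rewrite /hi /lo (bigD1 a) //= -addrA [w a + _]addrC. Qed.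

Lemma partition_lo_ge a : l <= lo a.
Proof. by rewrite /lo lerDl sumr_ge0 // => b _; apply: ltW. Qed.

Lemma partition_sum_sub (P Q : pred A) :
  (forall b, P b -> Q b) -> \sum_(b | P b) w b <= \sum_(b | Q b) w b.
Proof.
move=> PQ; rewrite big_mkcond [leRHS]big_mkcond /=; apply: ler_sum => b _.
by case: ifPn => [/PQ -> //|_]; case: ifP => // _; apply: ltW.
Qed.

Lemma partition_hi_le a : hi a <= r.
Proof. by rewrite lerD2l; apply: partition_sum_sub. Qed.

Lemma partition_lt a b : le a b -> a != b -> hi a <= lo b.
Proof.
move=> ab neq_ab; rewrite lerD2l; apply: partition_sum_sub => c ca.
rewrite (le_tr ca ab); apply: contra neq_ab => /eqP cb.
by apply/eqP/le_anti; rewrite ab -cb.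
Qed.

Lemma partition_uniq a b (x : R) :
  lo a <= x < hi a -> lo b <= x < hi b -> a = b.
Proof.
move=> /andP[? ?] /andP[? ?]; apply/eqP/negPn/negP => neq.
have [/partition_lt|/partition_lt] := orP (le_total a b).
  by move/(_ neq); lra.
by rewrite eq_sym => /(_ neq); lra.
Qed.

Lemma partition_first a : (forall b, ~~ (le b a && (b != a))) -> lo a = l.
Proof. by move=> fst_a; rewrite /lo big_pred0 ?addr0 // => b; apply/negbTE. Qed.

Lemma partition_last a : (forall b, le b a) -> hi a = r.
Proof. by move=> lst_a; congr (_ + _); apply: eq_bigl => b; rewrite lst_a. Qed.

Let least (P : pred A) a0 : P a0 -> exists2 a, P a & forall b, P b -> le a b.
Proof.
move=> Pa0; pose m := sort le (enum P).
have: a0 \in m by rewrite mem_sort mem_enum.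
have: sorted le m by apply: sort_sorted.
have: forall b, P b -> b \in m by move=> b Pb; rewrite mem_sort mem_enum.
have: forall b, b \in m -> P b by move=> b; rewrite mem_sort mem_enum.
case: m => // a m mP Pm; rewrite /= (path_sortedE le_tr) => /andP[/allP am _] _.
exists a; first by apply: mP; rewrite mem_head.
by move=> b /Pm; rewrite in_cons => /orP[/eqP -> //|/am].
Qed.

Lemma partition_least (a0 : A) : exists a, forall b, le a b.
Proof. by have [//|a _ aP] := @least predT a0; exists a => b; apply: aP. Qed.

(** The witness is the successor of [a], the least letter strictly above it. *)
Lemma partition_next (a c : A) : le a c -> a != c -> exists b, [/\ a != b & lo b = hi a].
Proof.
move=> ac neq.
have [|b /andP[ab neq_ab] bP] := @least (fun b => le a b && (a != b)) c.
  by rewrite ac.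
exists b; split=> //; congr (_ + _); apply: eq_bigl => x.
apply/andP/idP => [[xb neq_xb]|xa].
  apply/negPn/negP => nxa; have ax : le a x.
    by have := le_total a x; rewrite (negbTE nxa) orbF.
  suff /bP bx: le a x && (a != x).
    by move/eqP: neq_xb; case; apply: le_anti; rewrite xb bx.
  by rewrite ax; apply: contra nxa => /eqP <-.
split; first exact: le_tr xa ab.
apply: contra neq_ab => /eqP xb; apply/eqP/le_anti.
by rewrite ab -xb.
Qed.

(** Among the intervals starting at or before [x], take the one that starts last; if [x] were past
    its right end, the next interval would also start at or before [x]. *)
Lemma partition_exists x : l <= x < r -> exists a, lo a <= x < hi a.
Proof.
move=> /andP[lx xr].
case: (pickP (@predT A)) => [a0 _|noA]; last first.
  by move: xr; rewrite /r big_pred0 // addr0; lra.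
have [a1 a1P] := partition_least a0.
have lo_a1 : lo a1 <= x.
  rewrite partition_first // => b; apply/negP => /andP[ba1 /eqP]; case.
  by apply: le_anti; rewrite ba1 a1P.
case: (@arg_maxP _ _ _ a1 (fun b => lo b <= x) lo lo_a1) => a lo_a maxa.
exists a; rewrite lo_a ltNge; apply/negP => hi_a.
have [lst_a|/existsNP[c /negP nca]] := pselect (forall b, le b a).
  by move: hi_a; rewrite partition_last // leNgt xr.
have ac : le a c by have := le_total a c; rewrite (negbTE nca) orbF.
have neq : a != c by apply: contra nca => /eqP <-.
have [b [_ lo_b]] := partition_next ac neq.
have := maxa b; rewrite lo_b => /(_ hi_a); rewrite partition_hiE.
by have := w_gt0 a; rewrite /Order.ge /=; lra.
Qed.

End Partition.

(** * The transformation, its inverse, and translation of orbit segments *)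

Section Dynamics.
Variables (R : realType) (A : finType).
Implicit Types (T : iet R A) (x y z s : R) (a b : A) (Q : seq R).

Definition in_dom T z := iet_l T <= z < iet_r T.

(** The inverse transformation: exchanging the two orders exchanges the semi-intervals with their
    images. *)
Definition swap T : iet R A :=
  Iet (iet_l T) (le2_order T) (le1_order T) (@len_gt0 _ _ T).

Lemma swapK T : swap (swap T) = T. Proof. by case: T. Qed.

Definition delta T a : R := nu T a - mu T a.

Lemma in_domP T z : reflect (iet_dom T z) (in_dom T z).
Proof. by apply: (iffP idP); rewrite /iet_dom /= in_itv. Qed.

Lemma in_semiE T a z : (z \in semi_interval T a) = (gamma T a <= z < mu T a).
Proof. by rewrite in_itv. Qed.

Lemma muE T a : mu T a = gamma T a + len T a.
Proof. exact: (partition_hiE (len T) (iet_l T) (le1_order T) a). Qed.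

Lemma gamma_swap T a : gamma (swap T) a = gamma T a + delta T a.
Proof. by rewrite /delta muE; have := muE (swap T) a; rewrite /nu /= /mu /=; lra. Qed.

Lemma gamma_lt_mu T a : gamma T a < mu T a.
Proof. by rewrite muE ltrDl len_gt0. Qed.

Lemma gamma_ge T a : iet_l T <= gamma T a.
Proof. exact: (partition_lo_ge (le1 T) (iet_l T) (@len_gt0 _ _ T) a). Qed.

Lemma mu_le T a : mu T a <= iet_r T.
Proof. exact: (partition_hi_le (le1 T) (iet_l T) (@len_gt0 _ _ T) a). Qed.

Lemma gamma_dom T a : in_dom T (gamma T a).
Proof. by rewrite /in_dom gamma_ge (lt_le_trans (gamma_lt_mu T a)) ?mu_le. Qed.

Lemma semi_dom T a z : z \in semi_interval T a -> in_dom T z.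
Proof.
rewrite in_semiE => /andP[lz zr]; rewrite /in_dom.
by rewrite (le_trans (gamma_ge T a) lz) (lt_le_trans zr (mu_le T a)).
Qed.

Lemma semi_uniq T a b z :
  z \in semi_interval T a -> z \in semi_interval T b -> a = b.
Proof. by rewrite !in_semiE; apply: (partition_uniq (le1_order T) (@len_gt0 _ _ T)). Qed.

Lemma semi_exists T z : in_dom T z -> exists a, z \in semi_interval T a.
Proof.
move=> zd; have [a az] := partition_exists (le1_order T) (@len_gt0 _ _ T) zd.
by exists a; rewrite in_semiE.
Qed.

Lemma iet_mapE T a z : z \in semi_interval T a -> iet_map T z = z + delta T a.
Proof.
move=> za; rewrite /iet_map; case: pickP => [b zb|no_a]; last by have := no_a a; rewrite za.
by rewrite (semi_uniq zb za) -addrA.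
Qed.

Lemma iet_map_swap T a z :
  z \in semi_interval T a -> iet_map T z \in semi_interval (swap T) a.
Proof.
move=> za; rewrite (iet_mapE za) in_semiE muE gamma_swap.
by move: za; rewrite in_semiE muE => /andP[? ?]; apply/andP => /=; lra.
Qed.

Lemma iet_map_dom T z : in_dom T z -> in_dom T (iet_map T z).
Proof. by move=> /semi_exists[a /iet_map_swap /semi_dom]. Qed.

Lemma iter_dom T n z : in_dom T z -> in_dom T (iter n (iet_map T) z).
Proof. by elim: n => // n IHn /IHn; rewrite iterS; apply: iet_map_dom. Qed.

Lemma delta_swap T a : delta (swap T) a = - delta T a.
Proof. by rewrite /delta /nu /mu /=; lra. Qed.

Lemma iet_mapK T z : in_dom T z -> iet_map (swap T) (iet_map T z) = z.
Proof.
move=> /semi_exists[a za]; rewrite (iet_mapE (iet_map_swap za)) (iet_mapE za).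
by rewrite delta_swap; lra.
Qed.

Lemma iet_mapVK T z : in_dom T z -> iet_map T (iet_map (swap T) z) = z.
Proof. by move=> zd; have := @iet_mapK (swap T) z zd; rewrite swapK. Qed.

Lemma iter_mapK T n z : in_dom T z ->
  iter n (iet_map (swap T)) (iter n (iet_map T) z) = z.
Proof.
elim: n z => // n IHn z zd.
by rewrite iterSr iterS iet_mapK ?IHn //; apply: iter_dom.
Qed.

Lemma iter_inj T n x y : in_dom T x -> in_dom T y ->
  iter n (iet_map T) x = iter n (iet_map T) y -> x = y.
Proof.
by move=> xd yd /(congr1 (iter n (iet_map (swap T)))); rewrite !iter_mapK.
Qed.

(** The ends of the domain are included so that points not separated by cuts are both inside or both
    outside the domain. *)
Definition cuts T : seq R :=
  [:: iet_l T, iet_r T & [seq gamma T a | a <- enum A] ++ [seq mu T a | a <- enum A]].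

Lemma gamma_cuts T a : gamma T a \in cuts T.
Proof. by rewrite !inE mem_cat map_f ?mem_enum ?orbT. Qed.

Lemma mu_cuts T a : mu T a \in cuts T.
Proof. by rewrite !inE mem_cat (map_f (mu T)) ?mem_enum ?orbT. Qed.

Lemma l_cuts T : iet_l T \in cuts T.
Proof. by rewrite !inE eqxx. Qed.

Lemma r_cuts T : iet_r T \in cuts T.
Proof. by rewrite !inE eqxx orbT. Qed.

(** No point of [Q] lies between [y] and [y + s], the larger one included. *)
Definition unseparated Q y s := forall q, q \in Q -> (q <= y) = (q <= y + s).

Lemma unseparated_dom T Q y s : {subset cuts T <= Q} -> in_dom T y ->
  unseparated Q y s -> in_dom T (y + s).
Proof.
move=> TQ /andP[ly yr] ys; rewrite /in_dom.
by rewrite -(ys _ (TQ _ (l_cuts T))) ly ltNge -(ys _ (TQ _ (r_cuts T))) -ltNge.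
Qed.

Lemma unseparated_semi T Q y s a : {subset cuts T <= Q} ->
  unseparated Q y s -> (y + s \in semi_interval T a) = (y \in semi_interval T a).
Proof.
move=> TQ ys; rewrite !in_semiE -(ys _ (TQ _ (gamma_cuts T a))).
by rewrite !ltNge -(ys _ (TQ _ (mu_cuts T a))).
Qed.

(** As long as no mark separates the two orbits, they visit the same semi-intervals and undergo the
    same displacements. Conditions before time [t] decide positions up to [t]. *)
Lemma iter_translate T Q y s t : {subset cuts T <= Q} -> in_dom T y ->
  (forall i, (i < t)%N -> unseparated Q (iter i (iet_map T) y) s) ->
  forall i, (i <= t)%N ->
    iter i (iet_map T) (y + s) = iter i (iet_map T) y + s.
Proof.
move=> TQ yd yQ; elim=> // i IHi it; rewrite !iterS IHi 1?ltnW //.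
have [a ya] := semi_exists (iter_dom i yd).
rewrite (iet_mapE ya) (iet_mapE (a := a)) ?(unseparated_semi _ TQ (yQ i it)) //.
by rewrite addrAC.
Qed.

(* The slacks are the smallest distances, over the first [t] iterates, to the
   marks on the left and on the right. *)
Lemma slack T Q y t : {subset cuts T <= Q} -> in_dom T y -> (0 < t)%N ->
  exists lo hi : R, [/\ 0 <= lo, 0 < hi,
    exists i q, [/\ (i < t)%N, q \in Q & lo = iter i (iet_map T) y - q],
    exists i q, [/\ (i < t)%N, q \in Q & hi = q - iter i (iet_map T) y] &
    forall s, (- lo <= s < hi) <->
      forall i, (i < t)%N -> unseparated Q (iter i (iet_map T) y) s].
Proof.
move=> TQ yd t_gt0; set f := fun i => iter i (iet_map T) y.
pose los := [seq iq.1 - iq.2 | iq <- [seq (f i, q) | i <- iota 0 t, q <- Q]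
                                & iq.2 <= iq.1].
pose his := [seq iq.2 - iq.1 | iq <- [seq (f i, q) | i <- iota 0 t, q <- Q]
                                & iq.1 < iq.2].
have /andP[ly yr] := yd.
have inp i q : (i < t)%N -> q \in Q ->
    (f i, q) \in [seq (f i, q) | i <- iota 0 t, q <- Q].
  by move=> it qQ; apply/allpairsP; exists (i, q); rewrite mem_iota.
have los_in i q : (i < t)%N -> q \in Q -> q <= f i -> f i - q \in los.
  move=> it qQ le_q; apply/mapP; exists (f i, q) => //.
  by rewrite mem_filter le_q inp.
have his_in i q : (i < t)%N -> q \in Q -> f i < q -> q - f i \in his.
  move=> it qQ le_q; apply/mapP; exists (f i, q) => //.
  by rewrite mem_filter le_q inp.
(* Both lists are nonempty: at time 0 the ends of the domain are marks on either side of [y]. *)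
have [lo lo_in loP] := seq_min (los_in 0%N _ t_gt0 (TQ _ (l_cuts T)) ly).
have [hi hi_in hiP] := seq_min (his_in 0%N _ t_gt0 (TQ _ (r_cuts T)) yr).
have [i1 [q1 [i1t q1Q q1_le loE]]] :
    exists i q, [/\ (i < t)%N, q \in Q, q <= f i & lo = f i - q].
  have /mapP[p + loE] := lo_in; rewrite mem_filter => /andP[le_p /allpairsP].
  move=> [[i q] /= [it qQ pE]]; move: it le_p loE; rewrite mem_iota pE /=.
  by exists i, q.
have [i2 [q2 [i2t q2Q q2_gt hiE]]] :
    exists i q, [/\ (i < t)%N, q \in Q, f i < q & hi = q - f i].
  have /mapP[p + hiE] := hi_in; rewrite mem_filter => /andP[le_p /allpairsP].
  move=> [[i q] /= [it qQ pE]]; move: it le_p hiE; rewrite mem_iota pE /=.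
  by exists i, q.
exists lo, hi; split.
- by rewrite loE subr_ge0.
- by rewrite hiE subr_gt0.
- by exists i1, q1.
- by exists i2, q2.
move=> s; split=> [/andP[lo_s s_hi] i it q qQ|sP].
  apply/idP/idP => le_q.
    by have := loP _ (los_in i q it qQ le_q); rewrite -/(f i); lra.
  rewrite leNgt; apply/negP => lt_q.
  by have := hiP _ (his_in i q it qQ lt_q); move: le_q; rewrite -/(f i); lra.
have := sP i1 i1t q1 q1Q; have := sP i2 i2t q2 q2Q.
rewrite -/(f i1) -/(f i2) q1_le leNgt q2_gt /= => /esym/negbT.
by rewrite -ltNge => + /esym; rewrite loE hiE => ? ?; apply/andP; lra.
Qed.

End Dynamics.

(** * Return times *)

(** Cuts are measured from the left end, which is itself an arbitrary real. *)
Definition has_height (R : realType) (A : finType) (T : iet R A)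
    (d : nat) (g : R) (H : nat) : Prop :=
  [/\ (2 <= d)%N /\ square_free d, 0 < g /\ (0 < H)%N,
      forall a, lattice d g H (delta T a) &
      forall q, q \in cuts T -> lattice d g H (q - iet_l T)].

Section Return.
Variables (R : realType) (A : finType).
Implicit Types (T : iet R A) (x y : R).

Section Height.
Variables (T : iet R A) (d : nat) (g : R) (H : nat).
Hypothesis T_height : has_height T d g H.

Lemma lattice_iter y i : in_dom T y ->
  lattice d g (H * i) (iter i (iet_map T) y - y).
Proof.
case: T_height => _ _ hdelta _ yd; elim: i => [|i IHi].
  by rewrite muln0 subrr; apply: lattice0.
have [c yc] := semi_exists (iter_dom i yd).
rewrite iterS (iet_mapE yc) addrAC mulnSr; exact: latticeD.
Qed.

Lemma lattice_iterB y t i j : in_dom T y -> (i < t)%N -> (j < t)%N ->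
  lattice d g (H * t) (iter i (iet_map T) y - iter j (iet_map T) y).
Proof.
move=> yd; wlog ji : i j / (j <= i)%N => [hwlog it jt|it jt].
  have [ji|/ltnW ij] := leqP j i; first exact: hwlog.
  by rewrite -opprB; apply/latticeN/hwlog.
rewrite -(subnK ji) iterD; apply: lattice_leq (lattice_iter _ (iter_dom j yd)).
by rewrite leq_mul2l; apply/orP; right; lia.
Qed.

(** The point [y] may lie outside the module, but it cancels: [hi + lo] is a difference of two
    points of its orbit plus a difference of two marks. *)
Lemma slack_lattice h (Q : seq R) y t lo hi : in_dom T y ->
  (forall q, q \in Q -> lattice d g h (q - iet_l T)) ->
  (exists i q, [/\ (i < t)%N, q \in Q & lo = iter i (iet_map T) y - q]) ->
  (exists i q, [/\ (i < t)%N, q \in Q & hi = q - iter i (iet_map T) y]) ->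
  lattice d g (H * t + (h + h)) (hi + lo).
Proof.
move=> yd hQ [i [q [it qQ ->]]] [j [q' [jt q'Q ->]]].
set u := iter i _ _; set v := iter j _ _.
have -> : q' - v + (u - q) = (u - v) + ((q' - iet_l T) - (q - iet_l T)) by lra.
by apply: latticeD; [apply: lattice_iterB | apply: latticeB; apply: hQ].
Qed.

End Height.

Lemma swap_height T d g H : has_height T d g H -> has_height (swap T) d g (H + H).
Proof.
move=> [dP [g0 H0] hdelta hcuts]; split=> //.
- by rewrite addn_gt0 H0.
- by move=> a; rewrite delta_swap; apply/latticeN/(lattice_leq _ (hdelta a))/leq_addr.
have hmu a : lattice d g (H + H) (nu T a - iet_l T).
  have -> : nu T a - iet_l T = delta T a + (mu T a - iet_l T) by rewrite /delta; lra.
  by apply: latticeD => //; apply: hcuts; apply: mu_cuts.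
have hgamma a : lattice d g (H + H) (gamma (swap T) a - iet_l T).
  rewrite gamma_swap [_ + delta T a]addrC -addrA.
  by apply: latticeD => //; apply: hcuts; apply: gamma_cuts.
move=> q; rewrite !inE mem_cat => /orP[/eqP ->|/orP[/eqP ->|/orP[]]].
- by apply: lattice_leq (hcuts _ (l_cuts T)); rewrite leq_addr.
- by apply: lattice_leq (hcuts _ (r_cuts T)); rewrite leq_addr.
- by move=> /mapP[a _ ->]; apply: hgamma.
- by move=> /mapP[a _ ->]; apply: hmu.
Qed.

(* For [t <= M], the point [T^(M - t) x] lies in an interval of points entering
   [[a, b[] at time exactly [t]; it has length at least a constant over
   [t + h], because its end points have height of that order. These intervals
   are disjoint, and the harmonic series diverges. *)
Lemma first_hit_bound T d g H : has_height T d g H ->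
  exists C, forall (h : nat) (a b : R) x (M : nat), (0 < h)%N ->
    lattice d g h (a - iet_l T) -> lattice d g h (b - iet_l T) ->
    in_dom T x -> a <= iter M (iet_map T) x < b ->
    (forall i, (i < M)%N -> ~~ (a <= iter i (iet_map T) x < b)) ->
    (M < C * h)%N.
Proof.
move=> T_height; have [[d1 dsq] [g0 H0] hdelta hcuts] := T_height.
(* [5 * H] arises from the height [H * t.+1 + 2 * (h + H)] of the slack, which is at most
   [5 * H * (t + h)]. *)
set L := iet_r T - iet_l T; pose c : R := g / (5 * H)%:R.
have c_gt0 : 0 < c by rewrite divr_gt0 ?ltr0n ?muln_gt0.
(* With this [j], a harmonic sum up to [h * 2 ^ j] exceeds [L / c] whatever [h], hence the constant
   [2 ^ j]. *)
pose j := (Num.truncn (2 * L / c)).+1.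
have jP : L < c * (j%:R / 2).
  have : 2 * L / c < j%:R by apply: truncnS_gt.
  by rewrite ltr_pdivrMr // => ?; lra.
exists (2 ^ j)%N => h a b x M h_gt0 ha hb xd hit nohit.
rewrite ltnNge; apply/negP => leM.
pose f := iet_map T; pose Q := [:: a, b & cuts T].
have TQ : {subset cuts T <= Q} by move=> q qT; rewrite 2!in_cons qT !orbT.
have hQ q : q \in Q -> lattice d g (h + H) (q - iet_l T).
  rewrite !in_cons => /orP[/eqP ->|/orP[/eqP ->|/hcuts]].
  - exact: lattice_leq (leq_addr _ _) ha.
  - exact: lattice_leq (leq_addr _ _) hb.
  - exact: lattice_leq (leq_addl _ _).
pose p (t : 'I_M.+1) := iter (M - t) f x.
have pd t : in_dom T (p t) by apply: iter_dom.
have pi t i : iter i f (p t) = iter (i + (M - t)) f x by rewrite iterD.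
have /choice[lo /choice[hi lohiP]] := fun t : 'I_M.+1 =>
  slack TQ (pd t) (ltn0Sn t).
(* Translating [p t] within its slack preserves the visits to [[a, b[], so the whole slack interval
   enters at time [t] exactly. *)
have firsthit (t : 'I_M.+1) (s : R) : - lo t <= s < hi t -> forall i, (i <= t)%N ->
    (a <= iter i f (p t + s) < b) = (i == t :> nat).
  have [_ _ _ _ sP] := lohiP t; move=> /sP unsep i it.
  rewrite (iter_translate TQ (pd t) (t := t)) // => [|k kt]; last first.
    by apply: unsep; apply: ltnW.
  have uQ := unsep i it.
  rewrite -(uQ a) ?inE ?eqxx // ltNge -(uQ b) ?inE ?eqxx ?orbT // -ltNge.
  rewrite -/f pi; have tM : (t <= M)%N by rewrite -ltnS.
  have [->|neq] := eqVneq i (t : nat); first by rewrite subnKC.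
  by apply/negbTE/nohit; lia.
have : \sum_(t in [set: 'I_M.+1]%SET) ((p t + hi t) - (p t - lo t)) <= L.
  apply: disjoint_intervals_sum.
  - by have /andP[? ?] := xd; rewrite /L; lra.
  - move=> t _; have [lo0 hi0 _ _ sP] := lohiP t.
    have /andP[lp pr] := pd t; split; last 1 first.
    + rewrite leNgt; apply/negP => rp.
      have /sP/(_ 0%N (ltn0Sn _))/(unseparated_dom TQ (pd t)) :
        - lo t <= iet_r T - p t < hi t by apply/andP; lra.
      by rewrite addrC subrK /in_dom ltxx andbF.
    + have /sP/(_ 0%N (ltn0Sn _))/(unseparated_dom TQ (pd t)) :
        - lo t <= - lo t < hi t by apply/andP; lra.
      by case/andP.
    + by lra.
  move=> t t' _ _ neq; apply/orP; rewrite leNgt [X in _ || X]leNgt -negb_and.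
  apply/negP => /andP[tt' t't].
  have [lo0 hi0 _ _ _] := lohiP t; have [lo0' hi0' _ _ _] := lohiP t'.
  (* [w] would be a common point of the two intervals, with two distinct entrance times. *)
  pose w := Num.max (p t - lo t) (p t' - lo t').
  have [w1 w2] : p t - lo t <= w /\ p t' - lo t' <= w by rewrite !le_max !lexx orbT.
  have [w3 w4] : w < p t + hi t /\ w < p t' + hi t' by rewrite !gt_max; split; apply/andP; lra.
  have /firsthit/(_ _) h1 : - lo t <= w - p t < hi t by apply/andP; lra.
  have /firsthit/(_ _) h2 : - lo t' <= w - p t' < hi t' by apply/andP; lra.
  rewrite !(addrC (p _)) !subrK in h1 h2.
  have [lt|lt|eq] := ltngtP t t'; last by move/eqP: neq; case; apply: val_inj.
  - by have := h1 _ (leqnn _); rewrite h2 1?ltnW // eqxx ltn_eqF.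
  - by have := h2 _ (leqnn _); rewrite h1 1?ltnW // eqxx ltn_eqF.
apply/negP; rewrite -ltNge; apply: lt_le_trans jP _.
apply: (@le_trans _ _ (c * \sum_(0 <= t < M.+1) ((t + h)%:R)^-1)).
  rewrite ler_wpM2l ?(ltW c_gt0) //; apply: le_trans (harmonic_lower_bound _ _ h_gt0) _.
  rewrite [leRHS](@big_cat_nat _ _ _ (h * (2 ^ j).-1)) //=; last first.
    by apply: leq_trans (leqW leM); rewrite mulnC leq_mul2r leq_pred orbT.
  by rewrite lerDl sumr_ge0 // => t _; rewrite invr_ge0 ler0n.
rewrite mulr_sumr big_mkord.
rewrite [leRHS](eq_bigl predT) => [|t]; last by rewrite inE.
apply: ler_sum => t _; have [lo0 hi0 loQ hiQ _] := lohiP t.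
have := slack_lattice T_height (pd t) hQ loQ hiQ.
move=> /(lattice_lower_bound d1 dsq g0)/(_ (ltr_wpDr lo0 hi0)) lb.
have th_gt0 : 0 < ((t + h)%N%:R : R) by rewrite ltr0n addn_gt0 h_gt0 orbT.
rewrite /c !ler_pdivrMr ?ltr0n ?muln_gt0 ?addn_gt0 ?h_gt0 ?orbT //.
have -> : p t + hi t - (p t - lo t) = hi t + lo t by lra.
apply: le_trans lb _; rewrite -mulrA -natrM ler_wpM2l ?addr_ge0 ?(ltW hi0) //.
by rewrite ler_nat; nia.
Qed.

End Return.

Lemma iter_period (X : Type) (f : X -> X) (k n : nat) (x : X) :
  iter k f x = x -> iter n f x = iter (n %% k) f x.
Proof.
move=> fx; rewrite {1}(divn_eq n k) addnC iterD iterM.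
by congr iter; elim: (n %/ k)%N => //= m ->.
Qed.

(** The rationals [p] and [q] are put in the same module so that [uniform_hitting] can use an
    interval with these offsets from the left end. *)
Lemma height_exists (R : realType) (A : finType) (T : iet R A) (d : nat)
    (p q : rat) : (2 <= d)%N -> square_free d ->
  (forall a, in_quadratic_field d (len T a)) ->
  exists g H, [/\ has_height T d g H, lattice d g H (ratr p : R) &
    lattice d g H (ratr q : R)].
Proof.
move=> d1 dsq Tlen.
pose f (i : A + bool) : R :=
  match i with inl a => len T a | inr b => ratr (if b then p else q) end.
have [|g [g0 [h hP]]] := @common_lattice R d (A + bool)%type f.
  by move=> [a|b] //=; exists (if b then p else q), 0; rewrite raddf0 mul0r addr0.
have hsum (P : pred A) : lattice d g (#|A| * h) (\sum_(b | P b) len T b).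
  by apply: lattice_sum => a; apply: (hP (inl a)).
have hmu a : lattice d g (#|A| * h) (mu T a - iet_l T) by rewrite addrC addKr.
have hnu a : lattice d g (#|A| * h) (nu T a - iet_l T) by rewrite addrC addKr.
exists g, (#|A| * h + #|A| * h + h).+1.
have le1 : (#|A| * h <= (#|A| * h + #|A| * h + h).+1)%N by lia.
split; last 2 first.
- by apply: lattice_leq (hP (inr true)); lia.
- by apply: lattice_leq (hP (inr false)); lia.
split=> //.
- move=> a; have -> : delta T a = (nu T a - iet_l T) - (mu T a - iet_l T).
    by rewrite /delta; lra.
  have := latticeB (hnu a) (hmu a); apply: lattice_leq; lia.
move=> x; rewrite !inE mem_cat => /orP[/eqP ->|/orP[/eqP ->|/orP[]]].
- by rewrite subrr; apply: lattice_leq (lattice0 _ _).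
- by apply: (lattice_leq le1); rewrite addrC addKr; apply: hsum.
- by move=> /mapP[a _ ->]; apply: (lattice_leq le1); rewrite addrC addKr; apply: hsum.
- by move=> /mapP[a _ ->]; apply: (lattice_leq le1).
Qed.

(** * Minimality *)

Section Minimality.
Variables (R : realType) (A : finType).
Implicit Types (T : iet R A) (x y : R).

Lemma iter_swap T n i y : (i <= n)%N -> in_dom T y ->
  iter i (iet_map (swap T)) (iter n (iet_map T) y) = iter (n - i) (iet_map T) y.
Proof.
by move=> le_in yd; rewrite -{1}(subnKC le_in) iterD iter_mapK ?iter_dom.
Qed.

(** Otherwise the backward orbit of [iter (C * h) f y] would first enter the interval at time
    [C * h], on reaching [y], against [first_hit_bound] for the inverse. *)
Lemma return_bound T d g H : has_height T d g H ->
  exists C, forall (h : nat) (a b y : R), (0 < h)%N ->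
    lattice d g h (a - iet_l T) -> lattice d g h (b - iet_l T) ->
    in_dom T y -> a <= y < b ->
    exists k, [/\ (0 < k)%N, (k <= C * h)%N & a <= iter k (iet_map T) y < b].
Proof.
move=> /swap_height/first_hit_bound[C CP]; exists C => h a b y h0 ha hb yd yU.
apply/not_existsP => noret.
have := CP h a b (iter (C * h) (iet_map T) y) (C * h)%N h0 ha hb.
rewrite iter_swap // subnn ltnn => /(_ (iter_dom _ yd) yU) absurd.
suff: false by []; apply: absurd => i iM; rewrite iter_swap ?(ltnW iM) //.
apply/negP => hit; apply: (noret (C * h - i)%N); split=> //.
  by rewrite subn_gt0.
exact: leq_subr.
Qed.

Lemma cut_gamma T x : x \in cuts T -> in_dom T x -> exists a, x = gamma T a.
Proof.
move=> xT xd; have [a xa] := semi_exists xd; exists a; apply/eqP.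
move: (xa); rewrite in_semiE eq_le => /andP[ax xmu]; rewrite ax andbT.
have lt b : b != a -> gamma T b <= x -> mu T b <= gamma T a.
  move=> ba bx; have [tot _ _] := le1_order T.
  have [le_ba|le_ab] := orP (tot b a).
    exact: (partition_lt (iet_l T) (le1_order T) (@len_gt0 _ _ T)).
  have := partition_lt (iet_l T) (le1_order T) (@len_gt0 _ _ T) le_ab.
  by rewrite eq_sym => /(_ ba); rewrite -/(mu T a) -/(gamma T b); lra.
move: xT; rewrite !inE mem_cat => /orP[/eqP ->|/orP[/eqP xr|/orP[]]].
- exact: gamma_ge.
- by move: xd; rewrite /in_dom xr ltxx andbF.
- move=> /mapP[b _ xE]; have [<-|ba] := eqVneq b a; first by rewrite xE.
  by have := lt b ba; rewrite xE lexx => /(_ isT); have := gamma_lt_mu T b; lra.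
- move=> /mapP[b _ xE]; have [ba|ba] := eqVneq b a.
    by move: xmu; rewrite xE ba ltxx.
  by have := lt b ba; rewrite xE => ->//; apply: ltW; apply: gamma_lt_mu.
Qed.

Lemma least_gamma T a : (forall b, le1 T a b) -> gamma T a = iet_l T.
Proof.
move=> aP; apply: partition_first => b; apply/negP => /andP[ba /eqP]; case.
by have [_ anti _] := le1_order T; apply: anti; rewrite ba aP.
Qed.

Lemma not_firstP T a : iet_l T < gamma T a <-> not_first T a.
Proof.
split=> [la|[b /andP[ba neq]]]; last first.
  have := partition_lt (iet_l T) (le1_order T) (@len_gt0 _ _ T) ba neq.
  rewrite -/(mu T b) -/(gamma T a); have := gamma_lt_mu T b.
  by have := gamma_ge T b; lra.
apply: contrapT => fst_a; move: la; rewrite [gamma T a]partition_first ?ltxx // => b.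
by apply/negP => ba; apply: fst_a; exists b.
Qed.

(** * Absence of connections and of periodic points *)

Section Regular.
Variable T : iet R A.
Hypotheses (T_regular : regular T) (T_nontrivial : exists c, not_first T c).

Local Notation f := (iet_map T).

Lemma gamma_aperiodic a k : not_first T a -> (0 < k)%N ->
  iter k f (gamma T a) <> gamma T a.
Proof.
move=> fa k0 per; have [+ _] := T_regular; move=> /(_ a fa); apply.
have per' n : iter n f (gamma T a) = iter (n %% k) f (gamma T a).
  exact: iter_period.
apply: (@sub_finite_set _ _ [set iter i f (gamma T a) | i in `I_k]%classic); last first.
  by apply: finite_image; apply: finite_II.
move=> w [/in_domP wd [n [<-|wn]]].
  by exists (n %% k)%N; [rewrite /= ltn_mod | rewrite -per'].
(* A preimage of order [n] is also a forward iterate: [n * k.-1] steps followed by [n] steps make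
   [n] periods. *)
exists ((n * k.-1) %% k)%N; first by rewrite /= ltn_mod.
rewrite -per'; apply: (@iter_inj _ _ T n) => //.
  by apply: iter_dom; apply: gamma_dom.
rewrite wn -iterD -mulnS prednK // per' modnMl //.
Qed.

(** Distinct letters would have intersecting orbits, and equal letters a periodic orbit. *)
Lemma gamma_connection a b n : not_first T a -> not_first T b ->
  iter n f (gamma T a) = gamma T b -> n = 0%N.
Proof.
move=> fa fb ab; have [_ dis] := T_regular.
have [eq_ab|neq] := eqVneq a b.
  apply/eqP/negPn/negP; rewrite -lt0n => n0.
  by apply: (@gamma_aperiodic a n fa n0); rewrite ab eq_ab.
have : (Defs.orbit T (gamma T a) `&` Defs.orbit T (gamma T b))%classic (gamma T b).
  split; split; try (apply/in_domP; exact: gamma_dom).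
    by exists n; left.
  by exists 0%N; left.
by rewrite dis.
Qed.

(** If both orders had the same first letter, the left end of the next interval in the second order
    would be mapped to that of the next interval in the first order, a connection of length 1. *)
Lemma first_image : exists b, not_first T b /\ f (gamma T b) = iet_l T.
Proof.
have [c fc] := T_nontrivial.
have [b bP] := partition_least (le2_order T) c.
have gb : gamma (swap T) b = iet_l T by apply: (@least_gamma (swap T)).
have fb : f (gamma T b) = iet_l T.
  by rewrite (iet_mapE (a := b)) ?in_semiE ?lexx ?gamma_lt_mu // -gamma_swap.
have [|nfb] := pselect (not_first T b); first by exists b.
have bl : gamma T b = iet_l T.
  apply/eqP; rewrite eq_le gamma_ge andbT leNgt.
  by apply/negP => /not_firstP.
have neq_bc : b != c by apply/eqP => bc; rewrite bc in nfb.
have le_bc : le1 T b c.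
  have [tot _ _] := le1_order T; have [//|cb] := orP (tot b c).
  by case: nfb; exists c; rewrite cb eq_sym.
have [b1 [_ b1E]] := partition_next (len T) (iet_l T) (le1_order T) le_bc neq_bc.
have [b2 [_ b2E]] := partition_next (len T) (iet_l T) (le2_order T) (bP c) neq_bc.
rewrite -/(gamma T b1) -/(mu T b) in b1E.
rewrite -/(gamma (swap T) b2) -/(mu (swap T) b) in b2E.
have muE2 : mu (swap T) b = mu T b by rewrite !muE gb bl.
have f2 : f (gamma T b2) = gamma T b1.
  by rewrite (iet_mapE (a := b2)) ?in_semiE ?lexx ?gamma_lt_mu // -gamma_swap b2E muE2.
have fb1 : not_first T b1.
  by apply/not_firstP; rewrite b1E; have := gamma_lt_mu T b; rewrite bl.
have fb2 : not_first T b2.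
  apply/not_firstP; rewrite lt_neqAle gamma_ge andbT; apply/eqP => b2l.
  have := f2; rewrite -b2l -bl fb => /esym eqb1.
  by move/not_firstP: fb1; rewrite eqb1 ltxx.
by have := @gamma_connection b2 b1 1%N fb2 fb1 f2.
Qed.

(** A periodic point can be moved left until its orbit meets a cut, which is then periodic. This cut
    is [gamma T a] with [a] not first, or else the left end, whose preimage given by [first_image]
    is then periodic. *)
Lemma aperiodic x k : in_dom T x -> (0 < k)%N -> iter k f x <> x.
Proof.
move=> xd k0 per.
have subTT : {subset cuts T <= cuts T} by [].
have [lo [hi [lo0 hi0 [i [q [ik qQ loE]]] _ sP]]] := slack subTT xd k0.
have /sP uns : - lo <= - lo < hi by apply/andP; lra.
have tr := iter_translate subTT xd uns.
have xlo_d : in_dom T (x - lo) by apply: unseparated_dom subTT xd (uns 0%N k0).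
have xlo_per : iter k f (x - lo) = x - lo by rewrite tr // per.
have qE : q = iter i f (x - lo) by rewrite tr ?(ltnW ik) // loE; lra.
have qd : in_dom T q by rewrite qE; apply: iter_dom.
have qper : iter k f q = q by rewrite qE -iterD addnC iterD xlo_per.
have [a qa] := cut_gamma qQ qd.
have [fa|nfa] := pselect (not_first T a).
  by apply: (gamma_aperiodic fa k0); rewrite -qa.
have ql : q = iet_l T.
  rewrite qa; apply/eqP; rewrite eq_le gamma_ge andbT leNgt.
  by apply/negP => /not_firstP.
have [b [fb bl]] := first_image.
apply: (gamma_aperiodic fb k0); apply: (@iter_inj _ _ T 1).
- by apply/iter_dom/gamma_dom.
- exact: gamma_dom.
by rewrite -iterS iterSr /= bl -ql qper.
Qed.

End Regular.

End Minimality.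

(** * Invariant sets decided by finitely many iterates *)

Section InvariantSets.
Variables (R : realType) (A : finType).
Implicit Types (T : iet R A) (x y : R) (W : pred R).

(** Boundary points: the sets used below are constant on a right neighbourhood of each point, so
    they change only from the left. *)
Definition left_jump T W x := in_dom T x /\
  forall e : R, 0 < e -> exists x', [/\ in_dom T x', x - e <= x', x' < x & W x' != W x].

Lemma left_jump_image T W c x :
  (forall y, in_dom T y -> W (iet_map T y) = W y) ->
  x \in semi_interval T c -> x != gamma T c -> left_jump T W x ->
  left_jump T W (iet_map T x).
Proof.
move=> WT xc neq [xd xj]; split=> [|e e0]; first exact: iet_map_dom.
move: (xc); rewrite in_semiE => /andP[gx xmu].
have lt_gx : gamma T c < x by rewrite lt_neqAle eq_sym neq.
have [|x' [x'd x'e x'x Wx']] := xj (Num.min e (x - gamma T c)).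
  by rewrite lt_min e0 subr_gt0.
have [e1 e2] : Num.min e (x - gamma T c) <= e /\
    Num.min e (x - gamma T c) <= x - gamma T c.
  by rewrite !ge_min !lexx orbT.
have x'c : x' \in semi_interval T c by rewrite in_semiE; apply/andP; lra.
exists (iet_map T x'); rewrite !WT // (iet_mapE x'c) (iet_mapE xc); split=> //; last 2 first.
- by lra.
- by lra.
by rewrite -(iet_mapE x'c); apply: iet_map_dom.
Qed.

Lemma left_jump_gt T W x : left_jump T W x -> iet_l T < x.
Proof.
move=> [_ /(_ 1 ltr01)[x' [/andP[lx' _] _ x'x _]]]; exact: le_lt_trans x'x.
Qed.

Lemma first_failure (P : nat -> Prop) : P 0%N ->
  (forall i, P i) \/ exists i, P i /\ ~ P i.+1.
Proof.
move=> P0; have [|noi] := pselect (exists i, P i /\ ~ P i.+1); first by right.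
left; elim=> // i Pi; apply: contrapT => nPi; apply: noi; by exists i.
Qed.

Variables (T : iet R A) (W : pred R) (N : nat) (Q : seq R).
Hypotheses (T_regular : regular T) (T_nontrivial : exists c, not_first T c).
Hypotheses (W_invariant : forall y, in_dom T y -> W (iet_map T y) = W y).
Hypotheses (N_gt0 : (0 < N)%N) (cutsQ : {subset cuts T <= Q}).
Hypothesis W_unseparated : forall y s, in_dom T y ->
  (forall i, (i < N)%N -> unseparated Q (iter i (iet_map T) y) s) -> W (y + s) = W y.

Local Notation f := (iet_map T).
Local Notation f' := (iet_map (swap T)).

Lemma left_jump_mark x : left_jump T W x ->
  exists i q, [/\ (i < N)%N, q \in Q & iter i f x = q].
Proof.
move=> [xd xj]; have [lo [hi [lo0 hi0 [i [q [iN qQ loE]]] _ sP]]] := slack cutsQ xd N_gt0.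
have [lo_gt0|lo_le0] := ltrP 0 lo; last by exists i, q; split=> //; lra.
have [x' [x'd x'lo x'x /eqP[]]] := xj lo lo_gt0.
rewrite -[x'](subrK x) addrC; apply: W_unseparated => //.
by apply/sP; apply/andP; lra.
Qed.

(** By [left_jump_mark] and injectivity, a left jump is determined by a time below [N] and a mark,
    so there are finitely many. *)
Lemma left_jump_pigeonhole (z : nat -> R) : (forall i, left_jump T W (z i)) ->
  exists i j, (i < j)%N /\ z i = z j.
Proof.
move=> zj; have /choice[n /choice[q nqP]] := fun i => left_jump_mark (zj i).
have nN i : (n i < N)%N by have [] := nqP i.
have qQ i : q i \in Q by have [] := nqP i.
pose F i := (Ordinal (nN i), SeqSub (qQ i)).
have [v vP] := infinite_pigeonhole F.
have [i _ Fi] := vP 0%N; have [j ij Fj] := vP i.+1.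
exists i, j; split=> //; have [_ _ qi] := nqP i; have [_ _ qj] := nqP j.
have [nij qij] : n i = n j /\ q i = q j by move: Fi; rewrite -Fj => -[].
apply: (@iter_inj _ _ T (n i)); [by case: (zj i) | by case: (zj j) | ].
by rewrite qi nij qj.
Qed.

(* Left jumps propagate along the forward orbit up to a [gamma c], and along the
   backward orbit up to some [T (gamma b)] or [T (T (gamma b))]. *)
Lemma no_left_jump x : ~ left_jump T W x.
Proof.
move=> xj; have [xd _] := xj.
have per := aperiodic T_regular T_nontrivial.
have [j [c [fc jc]]] : exists j c, not_first T c /\ iter j f x = gamma T c.
  have [allj|[j [jj nj]]] := @first_failure (fun i => left_jump T W (iter i f x)) xj.
    have [i [j [ij eq_ij]]] := left_jump_pigeonhole allj.
    exfalso; apply: (per (iter i f x) (j - i)%N); rewrite ?subn_gt0 ?iter_dom //.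
    by rewrite -iterD subnK ?(ltnW ij).
  have [c xc] := semi_exists (iter_dom j xd).
  have [xg|xg] := eqVneq (iter j f x) (gamma T c); last first.
    by case: nj; rewrite iterS; apply: left_jump_image xc xg jj.
  by exists j, c; split=> //; apply/not_firstP; rewrite -xg; apply: left_jump_gt jj.
have xd' : in_dom (swap T) x by [].
have [k [b [fb kb]]] : exists k b, not_first T b /\ x = iter k.+1 f (gamma T b).
  have iterK i : iter i f (iter i f' x) = x.
    by rewrite -[in iter i f](swapK T); apply: iter_mapK.
  have [allj|[i [ij nj]]] := @first_failure (fun i => left_jump T W (iter i f' x)) xj.
    have [i [k [ik eq_ik]]] := left_jump_pigeonhole allj.
    exfalso; apply: (per x (k - i)%N); rewrite ?subn_gt0 //.
    rewrite -[in LHS](iterK i) -iterD subnK ?(ltnW ik) //.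
    by rewrite eq_ik iterK.
  have [b xb] := semi_exists (iter_dom i xd').
  have [xg|xg] := eqVneq (iter i f' x) (gamma (swap T) b); last first.
    case: nj; rewrite iterS; apply: left_jump_image xb xg ij => y yd.
    by rewrite -W_invariant ?iet_mapVK //; apply: (iet_map_dom (T := swap T)).
  have fgb : f (gamma T b) = gamma (swap T) b.
    by rewrite (iet_mapE (a := b)) ?in_semiE ?lexx ?gamma_lt_mu // gamma_swap.
  have xE : x = iter i.+1 f (gamma T b) by rewrite iterSr fgb -xg iterK.
  have [fb|nfb] := pselect (not_first T b); first by exists i, b.
  have bl : gamma T b = iet_l T.
    apply/eqP; rewrite eq_le gamma_ge andbT leNgt.
    by apply/negP => /not_firstP.
  (* If [b] is first, its left end is the image of [gamma T b0], one step earlier. *)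
  have [b0 [fb0 b0l]] := first_image T_regular T_nontrivial.
  by exists i.+1, b0; rewrite iterSr b0l -bl.
(* The backward and forward parts together form a connection of positive length. *)
have := @gamma_connection _ _ _ T_regular b c (j + k.+1) fb fc.
by rewrite iterD -kb jc addnS => /(_ erefl).
Qed.

(** Connectedness argument: let [s] be the supremum of the points up to which [W] keeps its value at
    [x]. Absence of left jumps gives this value at [s], and the right slack carries it beyond
    [s]. *)
Lemma invariant_trivial x y : in_dom T x -> in_dom T y -> W x = W y.
Proof.
wlog lt_xy : x y / x < y => [hwlog xd yd|xd yd].
  have [lt|gt|-> //] := ltgtP x y; first exact: hwlog.
  by apply: esym; apply: hwlog.
pose S := [set u : R | x <= u <= y /\ forall v, x <= v <= u -> W v = W x]%classic.
have domP u : x <= u <= y -> in_dom T u.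
  by move: xd yd => /andP[? ?] /andP[? ?] /andP[? ?]; apply/andP; lra.
have Sx : S x.
  by split=> [|v /le_anti ->//]; rewrite lexx ltW.
have Sub : has_ubound S by exists y => u [/andP[]].
have supS : has_sup S by split=> //; exists x.
set s := sup S.
have xs : x <= s by apply: ub_le_sup.
have sy : s <= y by apply: ge_sup; [exists x | move=> u [/andP[]]].
have sd : in_dom T s by apply: domP; rewrite xs.
have below u : x <= u -> u < s -> W u = W x.
  move=> xu us; have [|v [_ vP] lt_v] := @sup_adherent R S (s - u) _ supS.
    by rewrite subr_gt0.
  by apply: vP; apply/andP; move: lt_v; rewrite -/s => ?; lra.
have [Ws|Ws] := eqVneq (W s) (W x); last first.
  have neq_xs : x < s by rewrite lt_neqAle xs andbT; apply: contraNneq Ws => <-.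
  exfalso; apply: (@no_left_jump s); split=> // e e0.
  exists (Num.max x (s - e)).
  have x's : Num.max x (s - e) < s by rewrite gt_max neq_xs; apply/andP; lra.
  have xx' : x <= Num.max x (s - e) by rewrite le_max lexx.
  split=> //; last 1 first.
  - by rewrite (below _ xx' x's) eq_sym.
  - by apply: domP; rewrite xx' (le_trans (ltW x's)).
  - by rewrite le_max lexx orbT.
have [lo [hi [lo0 hi0 _ _ sP]]] := slack cutsQ sd N_gt0.
have right u : s <= u -> u < s + hi -> W u = W x.
  move=> su us; rewrite -Ws -[u](subrK s) addrC; apply: W_unseparated => //.
  by apply/sP; apply/andP; lra.
have [|ys] := leP y s; first by move=> ?; rewrite -Ws; congr W; lra.
have [yhi|hiy] := ltP y (s + hi); first by rewrite right.
suff: S (s + hi / 2) by move=> /(ub_le_sup Sub); rewrite -/s; lra.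
split; first by apply/andP; lra.
move=> v /andP[xv vs]; have [vlt|vge] := ltP v s; first exact: below.
by apply: right => //; lra.
Qed.

End InvariantSets.

(** * Uniform hitting times and recurrence of factors *)

Section Minimal.
Variables (R : realType) (A : finType) (T : iet R A).
Hypotheses (T_regular : regular T) (T_nontrivial : exists c, not_first T c).
Hypothesis T_quadratic : over_quadratic_field T.

Local Notation f := (iet_map T).

Lemma uniform_hitting (a b : R) : iet_l T <= a -> a < b -> b <= iet_r T ->
  exists N, forall x, in_dom T x ->
    exists2 n, (n < N)%N & a <= iter n f x < b.
Proof.
move=> la ab br; have [d [d1 dsq Tlen]] := T_quadratic.
(* Rational offsets from the left end give [[u, v[], inside [[a, b[], end points of bounded
   height. *)
have [p /itvP pP] : exists p, ratr p \in `](a - iet_l T), (b - iet_l T)[.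
  by apply: rat_in_itvoo; lra.
have [q /itvP qP] : exists q, ratr q \in `](ratr p : R), (b - iet_l T)[.
  by apply: rat_in_itvoo; rewrite pP.
pose u := iet_l T + ratr p; pose v := iet_l T + ratr q.
have [au uv vb] : [/\ a < u, u < v & v < b].
  have := pP; have := qP; rewrite /u /v => qP' pP'; split.
  - by rewrite -ltrBlDl pP'.
  - by rewrite ltrD2l qP'.
  - by rewrite -ltrBrDl qP'.
have [g [H [T_height hp hq]]] := height_exists p q d1 dsq Tlen.
have [_ [_ H0] _ _] := T_height.
have [C CP] := first_hit_bound T_height; have [C' CP'] := return_bound T_height.
have hu : lattice d g H (u - iet_l T) by rewrite /u addrAC subrr add0r.
have hv : lattice d g H (v - iet_l T) by rewrite /v addrAC subrr add0r.
pose N := (C * H).+1.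
have bounded x : in_dom T x -> (exists n, u <= iter n f x < v) ->
    exists2 n, (n < N)%N & u <= iter n f x < v.
  move=> xd ex; case: (ex_minnP ex) => n hit nmin; exists n => //.
  apply: leqW; apply: (CP H u v x n) => // i in_; apply/negP => /nmin.
  by rewrite leqNgt in_.
pose W : pred R := fun x => [exists n : 'I_N, u <= iter n f x < v].
have WP x : in_dom T x -> reflect (exists n, u <= iter n f x < v) (W x).
  move=> xd; apply: (iffP existsP) => [[n ?]|ex]; first by exists n.
  by have [n nN ?] := bounded x xd ex; exists (Ordinal nN).
have W_inv y : in_dom T y -> W (f y) = W y.
  move=> yd; apply/(WP _ (iet_map_dom yd))/(WP _ yd) => -[n].
    by rewrite -iterSr; exists n.+1.
  (* A visit at time 0 is lost on passing to [f y]; the return bound supplies a later one. *)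
  case: n => [hit|n]; last by rewrite iterSr; exists n.
  have [[|k] [// _ _ hitk]] := CP' H u v y H0 hu hv yd hit.
  by exists k; rewrite -iterSr.
pose Q := [:: u, v & cuts T].
have TQ : {subset cuts T <= Q} by move=> x xT; rewrite 2!in_cons xT !orbT.
have W_uns y s : in_dom T y ->
    (forall i, (i < N)%N -> unseparated Q (iter i f y) s) -> W (y + s) = W y.
  move=> yd uns; apply: eq_existsb => n.
  rewrite (iter_translate TQ yd uns) ?(ltnW (ltn_ord n)) //.
  have unsn := uns n (ltn_ord n).
  by rewrite -(unsn u) ?inE ?eqxx // !ltNge -(unsn v) ?inE ?eqxx ?orbT.
have ud : in_dom T u by apply/andP; lra.
exists N => x xd; have Wu : W u by apply/(WP u ud); exists 0%N; rewrite /= lexx.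
have Wx : W x by rewrite (invariant_trivial T_regular T_nontrivial W_inv _ TQ W_uns xd ud).
have [n nN /andP[un nv]] := bounded x xd (elimT (WP x xd) Wx).
by exists n => //; apply/andP; lra.
Qed.

(** All points of a short interval to the right of [iter k f x] share its next [n] letters, and the
    orbit of [y] enters this interval. *)
Lemma same_itinerary (x y : R) (k n : nat) : in_dom T x -> in_dom T y ->
  exists m, forall i, (i < n)%N -> forall a,
    (iter (m + i) f y \in semi_interval T a) =
    (iter (k + i) f x \in semi_interval T a).
Proof.
move=> xd yd; set u := iter k f x; have ud : in_dom T u by apply: iter_dom.
have subTT : {subset cuts T <= cuts T} by [].
have [lo [hi [lo0 hi0 _ _ sP]]] := slack subTT ud (ltn0Sn n).
have lur : iet_l T <= u /\ u + hi <= iet_r T.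
  split; first by case/andP: ud.
  rewrite leNgt; apply/negP => lt_r; have /andP[_ ur] := ud.
  have /sP/(_ 0%N isT)/(unseparated_dom subTT ud) :
    - lo <= iet_r T - u < hi by apply/andP; lra.
  by rewrite addrC subrK /in_dom ltxx andbF.
have [|N NP] := uniform_hitting lur.1 _ lur.2; first by rewrite ltrDl.
have [m _ /andP[mu um]] := NP y yd; exists m => i iN a.
have /sP uns : - lo <= iter m f y - u < hi by apply/andP; lra.
rewrite addnC iterD [(k + i)%N]addnC iterD -/u.
rewrite -(subrK u (iter m f y)) [_ + u]addrC.
have it : (i < n.+1)%N by apply: ltnW.
by rewrite (iter_translate subTT ud uns) ?(ltnW it) // (unseparated_semi _ subTT (uns i it)).
Qed.

End Minimal.

(** * Induced maps *)

Section ShortReturns.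
Variables (R : realType) (A : finType) (T : iet R A).
Hypotheses (T_regular : regular T) (T_nontrivial : exists c, not_first T c).
Variables (d : nat) (g : R) (H : nat).
Hypothesis T_height : has_height T d g H.

Local Notation f := (iet_map T).
Local Notation l := (iet_l T).

Lemma l_dom : in_dom T l.
Proof. by have [b [_ <-]] := first_image T_regular T_nontrivial; apply/iet_map_dom/gamma_dom. Qed.

(** Were the first [n.+3] points of the orbit of [l] pairwise at least [e = L / n.+1] apart,
    disjoint intervals of length [e] would start at them within a total length
    [L + e = n.+2 * e]. *)
Lemma short_displacement n : exists e : R,
  [/\ 0 < e, e * n.+1%:R <= iet_r T - l & lattice d g (H * n.+3) e].
Proof.
set L := iet_r T - l; have L_gt0 : 0 < L by have := l_dom; rewrite /in_dom /L; lra.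
pose e : R := L / n.+1%:R; have e_gt0 : 0 < e by rewrite divr_gt0 ?ltr0n.
have eL : e * n.+1%:R = L by rewrite /e divfK // pnatr_eq0.
pose p (i : 'I_n.+3) := iter i f l; have pd i : in_dom T (p i) by apply/iter_dom/l_dom.
have [[i [j [neq lt_e]]]|far] :=
    pselect (exists i j, i != j /\ `|p i - p j| < e).
  exists `|p i - p j|; split.
  - rewrite normr_gt0 subr_eq0.
    wlog lt_ij : i j neq lt_e / (i < j)%N => [hwlog|].
      have [lt|lt|eq] := ltngtP i j; first exact: hwlog.
        by rewrite eq_sym; apply: hwlog; rewrite // 1?eq_sym // distrC.
      by move/eqP: neq; case; apply: val_inj.
    apply/eqP => pij; apply: (aperiodic T_regular T_nontrivial (pd i) (k := j - i)).
      by rewrite subn_gt0.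
    by rewrite /p -iterD subnK ?(ltnW lt_ij).
  - by rewrite -eL ler_pM2r ?ltr0n // ltW.
  - have lat i' j' : lattice d g (H * n.+3) (p i' - p j').
      by apply: (lattice_iterB T_height l_dom).
    by case: (ler0P (p i - p j)) => _; rewrite ?opprB.
exfalso; have : \sum_(i in [set: 'I_n.+3]%SET) ((p i + e) - p i) <= iet_r T + e - l.
  apply: disjoint_intervals_sum; first by rewrite /L in L_gt0; lra.
    move=> i _; have /andP[? ?] := pd i; split=> //; by lra.
  move=> i j _ _ neq; apply/orP; rewrite leNgt [X in _ || X]leNgt -negb_and.
  by apply/negP => /andP[? ?]; apply: far; exists i, j; rewrite ltr_norml; split=> //; apply/andP; lra.
under eq_bigr do rewrite addrAC subrr add0r.
rewrite sumr_const cardsT card_ord -mulr_natr; rewrite /L in eL.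
have -> : n.+3%:R = n.+1%:R + 2 :> R by rewrite -natrD addn2.
by rewrite mulrDr eL => ?; lra.
Qed.

End ShortReturns.

Lemma cat_mkseq (X : Type) (x : nat -> X) (s1 s2 : seq X) k :
  s1 ++ s2 = mkseq x k -> s1 = mkseq x (size s1).
Proof.
move=> E; have le_k : (size s1 <= k)%N.
  by rewrite -(size_mkseq x k) -E size_cat leq_addr.
rewrite -[LHS](take_size_cat s2 erefl) E /mkseq -map_take take_iota.
by rewrite (minn_idPl le_k).
Qed.

(** * First return maps to base intervals and their cells *)

Section InducedMaps.
Variables (R : realType) (A : finType) (T : iet R A).
Variables (eps : nat -> R) (K : nat -> nat).

Local Notation f := (iet_map T).
Local Notation l := (iet_l T).

Definition base n y := l <= y < l + eps n.

Hypothesis eps_gt0 : forall n, 0 < eps n.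
Hypothesis eps_le : forall n, l + eps n <= iet_r T.
Hypothesis base_return : forall n y, base n y ->
  exists k, [/\ (0 < k)%N, (k <= K n)%N & base n (iter k f y)].

(** Index [k] of the search stands for time [k.+1], time 0 not being a return. *)
Definition ret n y := (find (fun k => base n (iter k.+1 f y)) (iota 0 (K n))).+1.

Definition first_return n y := iter (ret n y) f y.

(* The end points of all the larger base intervals are marked too, so that
   the cells of a base interval refine those of the larger ones. *)
Definition marks n : seq R := cuts T ++ [seq l + eps j | j <- iota 0 n.+1].

(** On a cell, the return time and the itinerary until the return are constant. Time [ret n y] is
    included so that both points return together. *)
Definition same_cell n y y' := [/\ base n y, base n y' &
  forall i, (i <= ret n y)%N -> unseparated (marks n) (iter i f y) (y' - y)].

Definition cell_start n y :=
  xget y [set p | same_cell n y p /\ forall p', same_cell n y p' -> p <= p']%classic.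

Lemma base_dom n y : base n y -> in_dom T y.
Proof. by move=> /andP[ly yn]; apply/andP; have := eps_le n; lra. Qed.

Lemma l_base n : base n l.
Proof. by apply/andP; have := eps_gt0 n; lra. Qed.

Lemma retP n y : base n y -> [/\ (ret n y <= K n)%N, base n (first_return n y) &
  forall i, (0 < i < ret n y)%N -> ~~ base n (iter i f y)].
Proof.
move=> /base_return[[|k] [// _ kK hit]].
have hasP : has (fun k => base n (iter k.+1 f y)) (iota 0 (K n)).
  by apply/hasP; exists k => //; rewrite mem_iota.
have findK := hasP; rewrite has_find size_iota in findK.
split=> //; first by have := nth_find 0%N hasP; rewrite nth_iota.
move=> [|i] // /andP[_ lt_i]; have iK : (i < K n)%N by apply: leq_trans findK; apply: ltnW.
by have := before_find 0%N lt_i; rewrite nth_iota // add0n => ->.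
Qed.

Lemma ret_eq n y k : base n y -> (0 < k)%N -> base n (iter k f y) ->
  (forall i, (0 < i < k)%N -> ~~ base n (iter i f y)) -> ret n y = k.
Proof.
move=> yb k0 kb kmin; have [_ rb rmin] := retP yb; apply/eqP; rewrite eqn_leq.
apply/andP; split; rewrite leqNgt; apply/negP => lt.
  by have := rmin k; rewrite k0 lt kb => /(_ isT).
by have := kmin (ret n y); rewrite lt rb => /(_ isT).
Qed.

Lemma cuts_marks n : {subset cuts T <= marks n}.
Proof. by move=> q qT; rewrite mem_cat qT. Qed.

Lemma eps_marks j n : (j <= n)%N -> l + eps j \in marks n.
Proof.
by move=> jn; rewrite mem_cat (map_f (fun j => l + eps j)) ?orbT // mem_iota.
Qed.

Lemma marks_sub n m : (n <= m)%N -> {subset marks n <= marks m}.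
Proof.
move=> nm q; rewrite !mem_cat => /orP[-> //|/mapP[j + ->]].
rewrite mem_iota => /andP[_ jn]; rewrite (map_f (fun j => l + eps j)) ?orbT //.
by rewrite mem_iota; apply: leq_trans jn _.
Qed.

Lemma unseparated_base j n y s : (j <= n)%N -> unseparated (marks n) y s ->
  base j (y + s) = base j y.
Proof.
move=> jn uns; rewrite /base -(uns l) ?cuts_marks ?l_cuts //.
by rewrite !ltNge -(uns (l + eps j)) ?eps_marks.
Qed.

Lemma unseparated_trans (Q : seq R) (y s s' : R) : unseparated Q y s ->
  unseparated Q (y + s) s' -> unseparated Q y (s + s').
Proof. by move=> u1 u2 q qQ; rewrite u1 // u2 // addrA. Qed.

Lemma unseparated_sym (Q : seq R) (y s : R) : unseparated Q y s -> unseparated Q (y + s) (- s).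
Proof. by move=> u1 q qQ; rewrite -u1 // addrK. Qed.

Section OneLevel.
Variable n : nat.

Lemma same_cell_iter y y' i : same_cell n y y' -> (i <= ret n y)%N ->
  iter i f y' = iter i f y + (y' - y).
Proof.
move=> [yb _ uns] ir; rewrite -[in LHS](subrK y y') [_ + y]addrC.
apply: (iter_translate (@cuts_marks n) (base_dom yb) _ ir) => j /ltnW; exact: uns.
Qed.

Lemma same_cell_ret y y' : same_cell n y y' -> ret n y' = ret n y.
Proof.
move=> yy'; have [yb y'b uns] := yy'; have [_ rb rmin] := retP yb.
apply: ret_eq => //.
  by rewrite (same_cell_iter yy') // (unseparated_base (leqnn n)) //; apply: uns.
move=> i /andP[i0 ir]; rewrite (same_cell_iter yy' (ltnW ir)).
rewrite (unseparated_base (leqnn n)) ?rmin ?i0 //; exact: uns (ltnW ir).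
Qed.

Lemma same_cell_refl y : base n y -> same_cell n y y.
Proof. by move=> yb; split=> // i _ q _; rewrite subrr addr0. Qed.

Lemma same_cell_sym y y' : same_cell n y y' -> same_cell n y' y.
Proof.
move=> yy'; have [yb y'b uns] := yy'; split=> // i; rewrite (same_cell_ret yy') => ir.
rewrite (same_cell_iter yy' ir) -(opprB y' y); exact: unseparated_sym (uns i ir).
Qed.

Lemma same_cell_trans y1 y2 y3 :
  same_cell n y1 y2 -> same_cell n y2 y3 -> same_cell n y1 y3.
Proof.
move=> s12 [_ y3b u23]; have [y1b _ u12] := s12; split=> // i ir.
have -> : y3 - y1 = (y2 - y1) + (y3 - y2) by lra.
apply: (unseparated_trans (u12 i ir)); rewrite -(same_cell_iter s12 ir).
by apply: u23; rewrite (same_cell_ret s12).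
Qed.

Lemma cell_exists y : base n y -> exists lo hi : R,
  [/\ 0 <= lo, 0 < hi, forall y', same_cell n y y' <-> y - lo <= y' < y + hi &
   exists i q, [/\ (i <= ret n y)%N, q \in marks n & lo = iter i f y - q]].
Proof.
move=> yb; have [lo [hi [lo0 hi0 loE _ sP]]] :=
  slack (@cuts_marks n) (base_dom yb) (ltn0Sn (ret n y)).
exists lo, hi; split=> // y'; split=> [[_ _ /sP/andP[? ?]]|/andP[? ?]].
  by apply/andP; lra.
have /sP uns : - lo <= y' - y < hi by apply/andP; lra.
split=> //; rewrite -(subrK y y') [_ + y]addrC (unseparated_base (leqnn n)) //.
exact: uns 0%N isT.
Qed.

Lemma cell_startP y : base n y ->
  same_cell n y (cell_start n y) /\
  forall p, same_cell n y p -> cell_start n y <= p.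
Proof.
move=> yb; apply: (@xgetPex _ y [set p | same_cell n y p /\ _]%classic).
have [lo [hi [lo0 hi0 cP _]]] := cell_exists yb; exists (y - lo).
by split=> [|p /cP/andP[]//]; apply/cP/andP; lra.
Qed.

Lemma cell_start_le y : base n y -> cell_start n y <= y.
Proof. by move=> yb; have [_] := cell_startP yb; apply; apply: same_cell_refl. Qed.

Lemma cell_start_same y y' : same_cell n y y' -> cell_start n y = cell_start n y'.
Proof.
move=> yy'; have [yb y'b _] := yy'.
have [s1 m1] := cell_startP yb; have [s2 m2] := cell_startP y'b.
apply/le_anti/andP; split.
  by apply: m1; apply: same_cell_trans yy' s2.
by apply: m2; apply: same_cell_trans (same_cell_sym yy') s1.
Qed.

Lemma cell_start_base y : base n y -> base n (cell_start n y).
Proof. by move=> /cell_startP[[]]. Qed.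

Lemma cell_start_id y : base n y -> cell_start n (cell_start n y) = cell_start n y.
Proof. by move=> /cell_startP[/cell_start_same]. Qed.

Lemma cell_start_max y p : base n y -> base n p -> cell_start n p = p -> p <= y ->
  p <= cell_start n y.
Proof.
move=> yb pb pE py; rewrite leNgt; apply/negP => lt.
have [lo [hi [lo0 hi0 cP _]]] := cell_exists yb.
have [/cP/andP[lo_s _] _] := cell_startP yb.
have /cell_start_same : same_cell n y p by apply/cP/andP; lra.
by rewrite pE => E; rewrite E ltxx in lt.
Qed.

Lemma cell_start_l : cell_start n l = l.
Proof.
apply/le_anti; rewrite cell_start_le ?l_base //=.
by have /cell_start_base/andP[] := l_base n.
Qed.

Lemma first_return_same y y' : same_cell n y y' ->
  first_return n y' = first_return n y + (y' - y).
Proof. by move=> yy'; rewrite /first_return (same_cell_ret yy') (same_cell_iter yy'). Qed.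

End OneLevel.

Definition start_coord n y := (cell_start n y - l) / eps n.

(** * Comparison of rescaled induced maps *)

Section Transfer.
Variable F : seq R.
Hypothesis F_start : forall n y, base n y -> start_coord n y \in F.
Hypothesis F_displacement : forall n y, base n y ->
  (first_return n y - y) / eps n \in F.

Definition point n (c : R) := l + eps n * c.

Lemma pointD n x y : point n (x + y) = point n x + eps n * y.
Proof. by rewrite /point mulrDr addrA. Qed.

Definition is_start n c := base n (point n c) && (cell_start n (point n c) == point n c).

(** The induced map rescaled to [[0, 1[]: which elements of [F] are cell starts, and the
    displacement at each. It ranges over a finite type, to which the pigeonhole applies. *)
Definition profile n : {ffun seq_sub F -> option (seq_sub F)} :=
  [ffun c => if is_start n (val c)
    then insub ((first_return n (point n (val c)) - point n (val c)) / eps n) else None].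

Lemma start_coordK n y : point n (start_coord n y) = cell_start n y.
Proof. by rewrite /point /start_coord mulrC divfK ?gt_eqF // addrC subrK. Qed.

Lemma start_coord_start n y : base n y -> is_start n (start_coord n y).
Proof.
move=> yb; rewrite /is_start start_coordK cell_start_base //=.
by rewrite cell_start_id.
Qed.

Lemma profile_start n m c : profile n = profile m -> c \in F ->
  is_start n c -> is_start m c /\
  (first_return n (point n c) - point n c) / eps n =
  (first_return m (point m c) - point m c) / eps m.
Proof.
move=> nm cF cn; have := congr1 (fun D : {ffun _} => D (SeqSub cF)) nm.
have bn : base n (point n c) by case/andP: cn.
rewrite !ffunE /= cn; case: ifP => [cm|_]; last first.
  by case: insubP => //; rewrite F_displacement.
have bm : base m (point m c) by case/andP: cm.
case: insubP => [u _ uE|]; last by rewrite F_displacement.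
case: insubP => [v _ vE|]; last by rewrite F_displacement.
by move=> [uv]; split=> //; rewrite -uE -vE uv.
Qed.

Lemma base_point n x : base n (point n x) = (0 <= x < 1).
Proof.
rewrite /base /point lerDl ltrD2l pmulr_rge0 //.
by rewrite -[X in _ < X]mulr1 ltr_pM2l.
Qed.

(** By symmetry one inequality suffices: the start found at level [n] is also a start at level [m],
    and [cell_start_max] applies. *)
Lemma profile_start_coord n m x : profile n = profile m -> 0 <= x < 1 ->
  start_coord n (point n x) = start_coord m (point m x).
Proof.
move=> nm x01; wlog suff le : n m nm / start_coord n (point n x) <= start_coord m (point m x).
  by apply/le_anti; rewrite !le.
have nb : base n (point n x) by rewrite base_point.
have mb : base m (point m x) by rewrite base_point.
have [sm _] := profile_start nm (F_start nb) (start_coord_start nb).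
have /andP[smb /eqP smE] := sm; set c := start_coord n _ in sm smb smE *.
have cx : c <= x.
  have := cell_start_le nb; rewrite -start_coordK -/c /point.
  by rewrite lerD2l ler_pM2l.
rewrite /start_coord ler_pdivlMr // lerBrDl mulrC.
apply: cell_start_max => //; by rewrite lerD2l ler_pM2l.
Qed.

(** A point is displaced like the start of its cell, where both profiles record the same rescaled
    displacement. *)
Lemma profile_first_return n m x : profile n = profile m -> 0 <= x < 1 ->
  exists x', [/\ 0 <= x' < 1, first_return n (point n x) = point n x' &
    first_return m (point m x) = point m x'].
Proof.
move=> nm x01; have cE := profile_start_coord nm x01.
have nb : base n (point n x) by rewrite base_point.
have mb : base m (point m x) by rewrite base_point.
set c := start_coord n _ in cE.
have [_ dE] := profile_start nm (F_start nb) (start_coord_start nb).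
have ret_n : first_return n (point n x) = point n x +
    (first_return n (point n c) - point n c).
  rewrite /c start_coordK; have [/first_return_same -> _] := cell_startP nb; lra.
have ret_m : first_return m (point m x) = point m x +
    (first_return m (point m c) - point m c).
  rewrite cE start_coordK; have [/first_return_same -> _] := cell_startP mb; lra.
exists (x + (first_return n (point n c) - point n c) / eps n).
have En : first_return n (point n x) =
    point n (x + (first_return n (point n c) - point n c) / eps n).
  by rewrite ret_n pointD mulrC divfK ?gt_eqF.
split=> //; first by rewrite -(base_point n) -En; have [] := retP nb.
by rewrite ret_m dE pointD mulrC divfK ?gt_eqF.
Qed.

Lemma profile_orbit n m k : profile n = profile m ->
  start_coord n (iter k (first_return n) l) = start_coord m (iter k (first_return m) l).
Proof.
move=> nm; suff [x [x01 -> ->]] : exists x, [/\ 0 <= x < 1,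
    iter k (first_return n) l = point n x & iter k (first_return m) l = point m x].
  exact: profile_start_coord.
elim: k => [|k [x [x01 nE mE]]].
  by exists 0; rewrite /point !mulr0 !addr0 lexx ltr01.
by rewrite !iterS nE mE; apply: profile_first_return.
Qed.

Lemma orbit_base n k : base n (iter k (first_return n) l).
Proof. by elim: k => [|k /retP[]//]; apply: l_base. Qed.

Definition return_time n k := (\sum_(j < k) ret n (iter j (first_return n) l))%N.

Lemma return_timeS n k : return_time n k.+1 =
  (return_time n k + ret n (iter k (first_return n) l))%N.
Proof. by rewrite /return_time big_ord_recr. Qed.

Lemma iter_return_time n k :
  iter (return_time n k) f l = iter k (first_return n) l.
Proof.
elim: k => [|k IHk]; first by rewrite /return_time big_ord0.
by rewrite return_timeS addnC iterD IHk.
Qed.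

Lemma return_time_ge n k : (k <= return_time n k)%N.
Proof.
elim: k => // k IHk; rewrite return_timeS -addn1.
by rewrite leq_add.
Qed.

(** * Words read along an orbit *)

Section Emission.
Variables (X : eqType) (e : R -> seq X).

Definition emit y t := flatten [seq e (iter i f y) | i <- iota 0 t].

Lemma emitD y s t : emit y (s + t) = emit y s ++ emit (iter s f y) t.
Proof.
rewrite /emit iotaD map_cat flatten_cat add0n -[in iota s t](addn0 s) iotaDl -map_comp.
by congr (_ ++ flatten _); apply: eq_map => i; rewrite /= addnC iterD.
Qed.

Definition return_word n y := emit y (ret n y).

Lemma emit_return_time n k : emit l (return_time n k) =
  flatten [seq return_word n (iter j (first_return n) l) | j <- iota 0 k].
Proof.
elim: k => [|k IHk]; first by rewrite /return_time big_ord0.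
rewrite return_timeS emitD IHk iter_return_time.
by rewrite -[in iota 0 k.+1]addn1 iotaD map_cat flatten_cat /= cats0.
Qed.

Lemma emit_morph (C : Type) n (x : infinite_word C) (coord : C -> R) k :
  (forall y y', same_cell n y y' -> forall i, (i < ret n y)%N ->
    e (iter i f y') = e (iter i f y)) ->
  (forall j, coord (x j) = start_coord n (iter j (first_return n) l)) ->
  emit l (return_time n k) =
  morph_ext (fun c => return_word n (point n (coord c))) (mkseq x k).
Proof.
move=> eP xP; rewrite emit_return_time /morph_ext /mkseq -map_comp.
congr flatten; apply: eq_map => j /=; rewrite xP start_coordK.
have [yy' _] := cell_startP (orbit_base n j).
rewrite /return_word /emit (same_cell_ret yy'); congr flatten.
by apply/eq_in_map => i; rewrite mem_iota => /andP[_ ir]; rewrite (eP _ _ yy').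
Qed.

End Emission.

(** * The substitution *)

Section Substitution.
Variables n m : nat.
Hypotheses (profile_nm : profile n = profile m) (le_nm : (n <= m)%N).
Hypothesis eps_nm : eps m <= eps n.

Local Notation C := (seq_sub [seq c <- F | is_start n c]).

Lemma start_coord_in y : base n y -> start_coord n y \in [seq c <- F | is_start n c].
Proof. by move=> yb; rewrite mem_filter start_coord_start ?F_start. Qed.

Definition letter0 : C := SeqSub (start_coord_in (l_base n)).

Definition letter y : C := insubd letter0 (start_coord n y).

Lemma val_letter y : base n y -> val (letter y) = start_coord n y.
Proof. by move=> yb; rewrite insubdK // start_coord_in. Qed.

Lemma letter_same y y' : same_cell n y y' -> letter y = letter y'.
Proof. by rewrite /letter /start_coord => /cell_start_same ->. Qed.

Lemma letter_hitting (c : C) :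
  (forall a b : R, l <= a -> a < b -> b <= iet_r T -> exists N, forall x,
    in_dom T x -> exists2 i, (i < N)%N & a <= iter i f x < b) ->
  exists N, forall y, in_dom T y -> exists2 i, (i < N)%N &
    base n (iter i f y) /\ letter (iter i f y) = c.
Proof.
move=> hit; have := valP c; rewrite /= mem_filter => /andP[/andP[pb /eqP pE] _].
set p := point n (val c) in pb pE; have [lo [hi [lo0 hi0 cP _]]] := cell_exists pb.
have /andP[lp pr] := base_dom pb.
have [||N NP] := hit p (Num.min (p + hi) (iet_r T)) lp.
- by rewrite lt_min pr ltrDl hi0.
- by rewrite ge_min lexx orbT.
exists N => y /NP[i iN]; rewrite lt_min => /and3P[py yp _]; exists i => //.
have py_same : same_cell n p (iter i f y) by apply/cP/andP; lra.
have [_ yb _] := py_same; split=> //; rewrite -(letter_same py_same).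
apply: val_inj; rewrite val_letter // /start_coord pE /p /point.
by rewrite addrAC subrr add0r mulrAC divff ?mul1r ?gt_eqF.
Qed.

Definition visit y : seq C := if base n y then [:: letter y] else [::].

Definition renormalized : infinite_word C := fun k => letter (iter k (first_return n) l).

(** The same coordinate [c] is read at level [m], and its image lists the cells of level [n] visited
    until the return to the smaller base. *)
Definition renormalization (c : C) : seq C := return_word visit m (point m (val c)).

Lemma base_sub y : base m y -> base n y.
Proof. by move=> /andP[? ?]; apply/andP; have := eps_nm; lra. Qed.

Lemma return_word_visit y : base n y -> return_word visit n y = [:: letter y].
Proof.
move=> yb; have [_ _ rmin] := retP yb.
have no_visit s : (forall i, i \in s -> (0 < i < ret n y)%N) ->
    flatten [seq visit (iter i f y) | i <- s] = [::].
  elim: s => //= i s IHs sP; rewrite IHs => [|j js]; last first.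
    by apply: sP; rewrite in_cons js orbT.
  by rewrite cats0 /visit (negbTE (rmin i _)) // sP ?mem_head.
rewrite /return_word /emit [iota _ _]/= map_cons [LHS]/= no_visit => [|i].
  by rewrite cats0 /visit yb.
by rewrite mem_iota add1n.
Qed.

(** A visit to the base of level [n] returns there no later than the return to the smaller base of
    level [m], so the marks of level [m], which include those of level [n], control the whole
    excursion. *)
Lemma visit_same y y' : same_cell m y y' -> forall i, (i < ret m y)%N ->
  visit (iter i f y') = visit (iter i f y).
Proof.
move=> yy' i ir; have [yb y'b uns] := yy'; rewrite (same_cell_iter yy' (ltnW ir)).
rewrite /visit (unseparated_base le_nm (uns i (ltnW ir))); case: ifP => // ib.
congr cons; apply/esym/letter_same; split=> //.
  by rewrite (unseparated_base le_nm (uns i (ltnW ir))).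
have ret_le : (ret n (iter i f y) + i <= ret m y)%N.
  have [_ rb _] := retP yb; have [_ _ rmin] := retP ib.
  rewrite leqNgt; apply/negP => lt.
  have := rmin (ret m y - i)%N; rewrite subn_gt0 ir -iterD subnK ?(ltnW ir) //.
  by rewrite (base_sub rb) => /(_ _)/negP; apply=> //; lia.
move=> j jr q qn; rewrite -iterD [iter i f y + _]addrC addrK.
by apply: uns; [lia | exact: marks_sub qn].
Qed.

Lemma emit_renormalized k : emit visit l (return_time n k) = mkseq renormalized k.
Proof.
rewrite emit_return_time /mkseq -(@eq_map _ _ (fun j => [:: renormalized j])).
  by elim: (iota 0 k) => //= j s ->.
by move=> j; rewrite return_word_visit ?orbit_base.
Qed.

Lemma emit_prefix t : emit visit l t = mkseq renormalized (size (emit visit l t)).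
Proof.
have := emit_renormalized t; rewrite -(subnKC (return_time_ge n t)) emitD.
exact: cat_mkseq.
Qed.

Lemma renormalization_prefix k :
  morph_ext renormalization (mkseq renormalized k) =
  mkseq renormalized (size (morph_ext renormalization (mkseq renormalized k))).
Proof.
suff <- : emit visit l (return_time m k) =
    morph_ext renormalization (mkseq renormalized k) by apply: emit_prefix.
apply: emit_morph; first exact: visit_same.
(* Equal profiles make [renormalized] the coding at level [m] too. *)
move=> j; rewrite val_letter ?orbit_base //; exact: profile_orbit.
Qed.

Lemma renormalization_letter0 : exists s, renormalization letter0 = letter0 :: s.
Proof.
have -> : letter0 = letter l by apply: val_inj; rewrite val_letter ?l_base.
rewrite /renormalization val_letter ?l_base //.
have -> : point m (start_coord n l) = l.
  by rewrite /start_coord cell_start_l subrr mul0r /point mulr0 addr0.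
by rewrite /return_word /emit /ret /= {1}/visit l_base; eexists.
Qed.

Hypothesis long_return : forall y, base m y -> (K n < ret m y)%N.

Lemma letter_point (c : C) : base m (point m (val c)).
Proof.
have := valP c; rewrite /= mem_filter => /andP[cn cF].
by have [/andP[]] := profile_start profile_nm cF cn.
Qed.

(** A return at level [m] is longer than [K n], so it includes visits at times 0 and [ret n y]. *)
Lemma size_renormalization c : (2 <= size (renormalization c))%N.
Proof.
have mb := letter_point c; set y := point m _ in mb.
have nb := base_sub mb; have [retK rb _] := retP nb.
rewrite /renormalization -/y /return_word.
have /subnKC <- : (ret n y < ret m y)%N by apply: leq_ltn_trans retK (long_return mb).
rewrite addSnnS emitD -[emit visit y _]/(return_word visit n y) return_word_visit //.
by rewrite /emit /= {1}/visit rb.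
Qed.

Lemma size_iter_renormalization c k :
  (k <= size (iter k (morph_ext renormalization) [:: c]))%N.
Proof.
have grow s : (size s * 2 <= size (morph_ext renormalization s))%N.
  elim: s => //= b s IHs; rewrite size_cat mulSn leq_add //.
  exact: size_renormalization.
suff : (k < size (iter k (morph_ext renormalization) [:: c]))%N by move/ltnW.
by elim: k => // k IHk; rewrite iterS; apply: leq_trans (grow _); lia.
Qed.

Lemma renormalization_fixed_point : is_fixed_point renormalization letter0 renormalized.
Proof.
have [s E] := renormalization_letter0; split.
- by rewrite E /= eqxx prefix0s.
- by move=> N; exists N => k Nk; apply: leq_trans Nk (size_iter_renormalization _ _).
elim=> [|k IHk]; first by rewrite /prefix_of /=; congr cons; apply: val_inj;
  rewrite /= val_letter ?l_base.
by rewrite /prefix_of iterS IHk; apply: renormalization_prefix.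
Qed.

Hypothesis all_letters : forall (b : C) y, base m y ->
  exists2 i, (i < ret m y)%N & base n (iter i f y) /\ letter (iter i f y) = b.

Lemma renormalization_primitive : primitive_morphism renormalization.
Proof.
exists 1%N => c b; rewrite /= /morph_ext /= cats0.
have [i ir [ib ibE]] := all_letters b (letter_point c).
apply/flattenP; exists (visit (iter i f (point m (val c)))).
  by apply/mapP; exists i; rewrite ?mem_iota.
by rewrite /visit ib ibE mem_head.
Qed.

Variable u : infinite_word A.
Hypothesis u_coding : forall i, iter i f l \in semi_interval T (u i).

Definition symbol y : seq A := [seq a <- enum A | y \in semi_interval T a].

Lemma symbolE y a : y \in semi_interval T a -> symbol y = [:: a].
Proof.
move=> ya; rewrite /symbol -(@eq_filter _ (pred1 a)).
  by rewrite filter_pred1_uniq ?enum_uniq ?mem_enum.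
move=> b /=; apply/eqP/idP => [-> //|yb]; exact: semi_uniq yb ya.
Qed.

Lemma emit_symbol t : emit symbol l t = mkseq u t.
Proof.
rewrite /emit /mkseq -(@eq_map _ _ (fun j => [:: u j])).
  by elim: (iota 0 t) => //= j s ->.
by move=> j; rewrite (symbolE (u_coding j)).
Qed.

Lemma symbol_image :
  is_image (fun c : C => return_word symbol n (point n (val c))) renormalized u.
Proof.
have E k : morph_ext (fun c : C => return_word symbol n (point n (val c)))
    (mkseq renormalized k) = mkseq u (return_time n k).
  rewrite -emit_symbol; apply/esym/emit_morph => [y y' yy' i ir|j]; last first.
    by rewrite val_letter ?orbit_base.
  have [_ _ uns] := yy'; rewrite (same_cell_iter yy' (ltnW ir)).
  apply: eq_filter => a; apply: (unseparated_semi _ (@cuts_marks n)).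
  exact: uns (ltnW ir).
split=> k; first by rewrite /prefix_of E size_mkseq.
by exists k; rewrite E size_mkseq return_time_ge.
Qed.

Lemma coding_primitive_morphic : primitive_morphic_word u.
Proof.
exists C, renormalization, letter0, renormalized,
  (fun c : C => return_word symbol n (point n (val c))).
split; [exact: renormalization_primitive | exact: renormalization_fixed_point |
  exact: symbol_image].
Qed.

End Substitution.

End Transfer.

End InducedMaps.

(** * Natural codings *)

Section Coding.
Variables (R : realType) (A : finType) (T : iet R A).

Definition codes (x : R) (c : infinite_word A) : Prop :=
  forall n, iter n (iet_map T) x \in semi_interval T (c n).

Lemma codes_exists x : in_dom T x -> exists c, codes x c.
Proof.
move=> xd; have /choice[c cP] := fun n => semi_exists (iter_dom n xd).
by exists c.
Qed.

Lemma codes_natural x c : codes x c <-> natural_coding T x c.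
Proof.
split=> [xc n a|xc n]; last exact/xc.
by split=> [<- //|]; apply: semi_uniq.
Qed.

Lemma interval_exchange_setE x c : codes x c ->
  interval_exchange_set T x = [set w | factor_of w c]%classic.
Proof.
move=> xc; apply/seteqP; split=> w; last by exists c => //; apply/codes_natural.
move=> [c' /codes_natural xc' wc'].
suff -> : c = c' by [].
by apply: funext => n; apply: semi_uniq (xc n) (xc' n).
Qed.

End Coding.

Lemma constant_word_primitive_morphic (A : finType) (a : A) :
  primitive_morphic_word (fun=> a).
Proof.
pose dbl (c : unit) := [:: tt; tt].
have nE s : s = nseq (size s) tt by elim: s => //= -[] s {1}->.
have sizeE k : size (iter k (morph_ext dbl) [:: tt]) = (2 ^ k)%N.
  elim: k => // k IHk; rewrite iterS expnS -IHk mul2n.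
  by elim: (iter _ _ _) => //= b s IHs; rewrite [size _]IHs.
have mkE (X : Type) (x : X) k : mkseq (fun=> x) k = nseq k x.
  by rewrite /mkseq; elim: k 0%N => //= k IHk i; rewrite IHk.
exists unit, dbl, tt, (fun=> tt), (fun=> [:: a]); split.
- exists 0%N => c b; rewrite /= mem_seq1; by case: c; case: b.
- split=> // [N|n]; last by rewrite /prefix_of mkE -nE.
  by exists N => n Nn; rewrite sizeE (leq_trans Nn) // ltnW // ltn_expl.
have imE n : morph_ext (fun=> [:: a]) (mkseq (fun=> tt) n) = nseq n a.
  by rewrite mkE; elim: n => //= n {1}<-.
split=> n; first by rewrite /prefix_of imE size_nseq mkE.
by exists n; rewrite imE size_nseq.
Qed.

(** * Choice of the base intervals and of the two levels *)

Section Quadratic.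
Variables (R : realType) (A : finType) (T : iet R A).
Hypotheses (T_regular : regular T) (T_nontrivial : exists c, not_first T c).
Hypothesis T_quadratic : over_quadratic_field T.

Local Notation f := (iet_map T).
Local Notation l := (iet_l T).

(* Base intervals [[l, l + eps n[] whose lengths and their conjugates have
   bounded product: their induced maps, once rescaled, involve finitely many
   break points and displacements. *)
Lemma base_lengths_exist : exists (eps : nat -> R) (K : nat -> nat) (F : seq R)
    (d : nat) (g : R) (H : nat), [/\ has_height T d g H,
  forall n, 0 < eps n /\ eps n * n.+1%:R <= iet_r T - l,
  forall n y, base T eps n y ->
    exists k, [/\ (0 < k)%N, (k <= K n)%N & base T eps n (iter k f y)],
  forall n y, base T eps n y -> start_coord T eps K n y \in F &
  forall n y, base T eps n y -> (first_return T eps K n y - y) / eps n \in F].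
Proof.
have [d [d1 dsq Tlen]] := T_quadratic.
have [g [H [T_height _ _]]] := height_exists 0 0 d1 dsq Tlen.
have [_ [g0 H0] _ hcuts] := T_height; set L := iet_r T - l.
have /choice[eps epsP] := short_displacement T_regular T_nontrivial T_height.
have [C CP] := return_bound T_height.
pose h n := (H * n.+3)%N; pose K n := (C * h n)%N.
have eps_gt0 n : 0 < eps n by have [] := epsP n.
have epsL n : eps n * n.+1%:R <= L by have [] := epsP n.
have epsh n : lattice d g (h n) (eps n) by have [] := epsP n.
have eps_le n : l + eps n <= iet_r T.
  rewrite -lerBrDl; apply: le_trans (epsL n).
  by rewrite ler_peMr ?(ltW (eps_gt0 n)) // ler1n.
have h_gt0 n : (0 < h n)%N by rewrite muln_gt0 H0.
have ret_ex n y : base T eps n y ->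
    exists k, [/\ (0 < k)%N, (k <= K n)%N & base T eps n (iter k f y)].
  move=> yb; have ha : lattice d g (h n) (l - l).
    by rewrite subrr; apply: lattice_leq (lattice0 _ _).
  have hb : lattice d g (h n) (l + eps n - l) by rewrite addrAC subrr add0r.
  exact: CP (h_gt0 n) ha hb (base_dom eps_le yb) yb.
have hmarks n q : q \in marks T eps n -> lattice d g (h n) (q - l).
  rewrite mem_cat => /orP[/hcuts|/mapP[j + ->]].
    by apply: lattice_leq; rewrite leq_pmulr.
  rewrite mem_iota addrAC subrr add0r => /andP[_ jn].
  by apply: lattice_leq (epsh j); rewrite leq_mul2l; apply/orP; right; lia.
(* Marks have height [h n] and displacements over at most [K n] steps have height [H * K n]. As
   [G n] is a multiple of [n.+3], the inequality [eps n * n.+3 <= 3 * L] bounds [eps n * G n],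
   whence [c]. *)
pose G n := (h n + H * K n)%N.
pose c : R := 3 * L * (H * (1 + H * C))%:R / g.
pose B := (Num.truncn c).+1.
have GB n : eps n * (G n)%:R <= B%:R * g.
  apply: (@le_trans _ _ (c * g)); last first.
    by rewrite ler_wpM2r ?(ltW g0) // ltW // truncnS_gt.
  have -> : G n = (n.+3 * (H * (1 + H * C)))%N by rewrite /G /K /h; ring.
  rewrite /c divfK ?gt_eqF // natrM mulrA ler_wpM2r //.
  apply: (@le_trans _ _ (3 * (eps n * n.+1%:R))); last by rewrite ler_wpM2l.
  rewrite mulrCA ler_wpM2l ?(ltW (eps_gt0 n)) // -natrM ler_nat; lia.
have [F FP] := lattice_ratio_finite d1 dsq g0 B.
have inF n e : lattice d g (G n) e -> `|e| <= eps n -> e / eps n \in F.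
  move=> eG en; have epsG : lattice d g (G n) (eps n).
    by apply: lattice_leq (epsh n); rewrite leq_addr.
  exact: FP eG epsG (eps_gt0 n) en (GB n) (GB n).
exists eps, K, F, d, g, H; split=> // n y yb.
  have yd := base_dom eps_le yb; apply: inF.
    have [lo [hi [lo0 hi0 cP [i [q [ir qm loE]]]]]] := cell_exists K eps_le yb.
    have [s1 s2] := cell_startP K eps_le yb.
    have -> : cell_start T eps K n y = y - lo.
      apply/le_anti; rewrite s2 /=; first by move/cP: s1 => /andP[].
      by apply/cP/andP; lra.
    have -> : y - lo - l = (q - l) - (iter i f y - y) by rewrite loE; lra.
    apply: latticeB; first exact: hmarks qm.
    apply: lattice_leq (lattice_iter T_height i yd).
    have [rK _ _] := retP ret_ex yb.
    by rewrite leq_mul2l (leq_trans ir rK) orbT.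
  have /andP[? ?] := cell_start_base K eps_le yb.
  by rewrite ger0_norm; lra.
have yd := base_dom eps_le yb; have [rK rb _] := retP ret_ex yb; apply: inF.
  apply: lattice_leq (lattice_iter T_height _ yd).
  by apply: leq_trans (leq_addl _ _); rewrite leq_mul2l rK orbT.
by move: yb rb => /andP[? ?] /andP[? ?]; rewrite ler_norml; apply/andP; lra.
Qed.

Lemma coding_of_left_end (u : infinite_word A) :
  codes T l u -> primitive_morphic_word u.
Proof.
move=> lu; have [eps [K [F [d [g [H [T_height epsP ret_ex F_start F_disp]]]]]]] :=
  base_lengths_exist.
have [[d1 dsq] [g0 H0] _ _] := T_height; set L := iet_r T - l in epsP.
have eps_gt0 n : 0 < eps n by have [] := epsP n.
have epsL n : eps n * n.+1%:R <= L by have [] := epsP n.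
have eps_le n : l + eps n <= iet_r T.
  rewrite -lerBrDl; apply: le_trans (epsL n).
  by rewrite ler_peMr ?(ltW (eps_gt0 n)) // ler1n.
have [v vP] := infinite_pigeonhole (profile T eps K F).
have [n _ nv] := vP 0%N.
have /choice[N NP] := fun c => letter_hitting eps_gt0 eps_le ret_ex F_start (n := n) c
  (uniform_hitting T_regular T_nontrivial T_quadratic).
(* Within [M] steps every orbit visits every cell of level [n]. The bound [m1] ensures
   [eps m <= eps n], and [m2] makes returns at level [m] longer than [K n + M]. *)
pose M := (\max_c N c)%N.
pose m1 := (Num.truncn (L / eps n)).+1.
pose m2 := (Num.truncn (L * (H * (K n + M))%:R / g)).+1.
have [m mge mv] := vP (n + m1 + m2)%N.
have nm : (n <= m)%N by lia.
have profile_nm : profile T eps K F n = profile T eps K F m by rewrite nv mv.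
have eps_nm : eps m <= eps n.
  have : L / eps n < m.+1%:R.
    by apply: lt_le_trans (truncnS_gt _) _; rewrite ler_nat -/m1; lia.
  rewrite ltr_pdivrMr // => lt_L; have := epsL m.
  by move=> /le_lt_trans/(_ lt_L); rewrite mulrC ltr_pM2l ?ltr0n // => /ltW.
have long y : base T eps m y -> (K n + M < ret T eps K m y)%N.
  move=> yb; have yd := base_dom eps_le yb; have [_ rb _] := retP ret_ex yb.
  rewrite ltnNge; apply/negP => le_ret.
  (* A return within [K n + M] steps would give a nonzero [e] with [g <= |e| * (H * (K n + M))],
     whereas [|e| < eps m <= L / m.+1]. *)
  set e := first_return T eps K m y - y.
  have e_neq0 : e != 0.
    by rewrite subr_eq0; apply/eqP; apply: (aperiodic T_regular T_nontrivial yd).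
  have e_lt : `|e| < eps m.
    by move: yb rb => /andP[? ?] /andP[? ?]; rewrite ltr_norml; apply/andP; rewrite /e; lra.
  have lat : lattice d g (H * ret T eps K m y) `|e|.
    have := lattice_iter T_height (ret T eps K m y) yd.
    by case: (ler0P e) => _ // /latticeN.
  have := lattice_lower_bound d1 dsq g0 lat; rewrite normr_gt0 => /(_ e_neq0).
  apply/negP; rewrite -ltNge.
  have lt1 : L * (H * (K n + M))%:R / g < m.+1%:R.
    by apply: lt_le_trans (truncnS_gt _) _; rewrite ler_nat -/m2; lia.
  rewrite -(@ltr_pM2l _ m.+1%:R) ?ltr0n //.
  move: lt1; rewrite ltr_pdivrMr //; apply: le_lt_trans.
  apply: (@le_trans _ _ (m.+1%:R * eps m * (H * (K n + M))%:R)).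
    rewrite -mulrA ler_wpM2l // ler_pM ?(ltW e_lt) //.
    by rewrite ler_nat leq_mul2l le_ret orbT.
  by rewrite ler_wpM2r // mulrC.
apply: (coding_primitive_morphic (F_start := F_start) F_disp profile_nm nm eps_nm
  _ _ lu) => [y /long|b y yb].
  by apply: leq_ltn_trans; apply: leq_addr.
have [i iN iP] := NP b y (base_dom eps_le yb); exists i => //.
apply: leq_trans iN _; apply: leq_trans (leq_bigmax b) _.
by apply: leq_trans (ltnW (long y yb)); apply: leq_addl.
Qed.

End Quadratic.

Theorem theorem5p12 (R : realType) (A : finType) (T : iet R A)
    (T_regular : regular T) (T_quadratic : over_quadratic_field T)
    (z : R) (z_dom : iet_dom T z) :
  primitive_morphic_set (interval_exchange_set T z).
Proof.
have zd : in_dom T z by apply/in_domP.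
have [c zc] := codes_exists zd; rewrite (interval_exchange_setE zc).
(* If every letter is first, there is only one letter and the coding is constant. *)
have [T_nontrivial|trivial] := pselect (exists a, not_first T a); last first.
  have eq_c : c = (fun=> c 0%N).
    apply: funext => n; apply/eqP/negPn/negP => neq; apply: trivial.
    have [tot _ _] := le1_order T; have [le|le] := orP (tot (c n) (c 0%N)).
      by exists (c 0%N), (c n); rewrite le neq.
    by exists (c n), (c 0%N); rewrite le eq_sym neq.
  by exists c => //; rewrite eq_c; apply: constant_word_primitive_morphic.
have ld := l_dom T_regular T_nontrivial.
have [u lu] := codes_exists ld.
(* The codings of [z] and of the left end have the same factors, so the latter coding can be
   used. *)
have transfer x y s t w : in_dom T x -> in_dom T y -> codes T x s -> codes T y t ->
    factor_of w s -> factor_of w t.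
  move=> xd yd xs yt [k wE].
  have [m mP] := same_itinerary T_regular T_nontrivial T_quadratic k (size w) xd yd.
  exists m; rewrite {1}wE; apply/eq_in_map => i; rewrite mem_iota => /andP[_ iw].
  by apply: semi_uniq (yt (m + i)%N); rewrite mP.
exists u; first exact: coding_of_left_end lu.
by apply/seteqP; split=> w; [apply: transfer zd ld zc lu | apply: transfer ld zd lu zc].
Qed.
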